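(* Let $\beta\in\mathbb R$ and let $(\tau_n^{\beta,321})_{n\ge1}$ be random permutations defined on a common probability space (with an arbitrary coupling), where $\tau_n^{\beta,321}$ is a Mallows random permutation of size $n$ with parameter $e^{\beta/n}$ conditioned to avoid $321$. If $\beta>0$, let $$f_\beta^{321}(x):=\frac12+\frac1\beta\log\left(\frac{e^{\beta x}+e^{\beta/2}}{1+e^{\beta/2}+e^\beta-e^{\beta x}}\right),\qquad x\in[0,1].$$ Then $\tau_n^{\beta,321}$ converges almost surely, in the sense of permutons, to the deterministic permuton $$\mu_\beta^{321}:=\Big(\big(X,f_\beta^{321}(X)\big)_\#+\big(f_\beta^{321}(X),X\big)_\#\Big)\left[\frac{\mathrm dx}{1+\exp\big(\beta(\frac12-x)\big)}\right].$$ If $\beta\le0$, then $\tau_n^{\beta,321}$ converges almost surely, in the sense of permutons, to the diagonal permuton.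
   Context: A permutation is $321$-avoiding if it has no decreasing subsequence of length $3$; $\mathrm{inv}(\sigma)$ is the number of inversions of $\sigma$. The law of $\tau_n^{\beta,321}$ is supported on $321$-avoiding permutations $\sigma$ of size $n$ with $\mathbb P(\tau_n^{\beta,321}=\sigma)=e^{\frac\beta n\mathrm{inv}(\sigma)}/Z_n^{\beta,321}$, where $Z_n^{\beta,321}=\sum_\sigma e^{\frac\beta n\mathrm{inv}(\sigma)}$ (sum over $321$-avoiding permutations of size $n$). A permuton is a Borel probability measure on $[0,1]^2$ with both marginals equal to Lebesgue measure on $[0,1]$. With a permutation $\sigma$ of size $n$ associate the permuton $\mu_\sigma$ that puts mass $1/n$ uniformly on each cell $[\frac{i-1}n,\frac in]\times[\frac{\sigma(i)-1}n,\frac{\sigma(i)}n]$, $1\le i\le n$. A sequence of permutations $\sigma_n$ converges to a permuton $\mu$ if $\mu_{\sigma_n}\to\mu$ weakly. The diagonal permuton is the push-forward of Lebesgue measure on $[0,1]$ by $x\mapsto(x,x)$. For a map $g$ and a measure $m$ on $[0,1]$, $g_\#m(A)=m(g^{-1}(A))$; $(X,h(X))_\#m$ and $(h(X),X)_\#m$ denote the push-forwards of $m$ by $x\mapsto(x,h(x))$ and $x\mapsto(h(x),x)$, and $(g_\#+h_\#)m:=g_\#m+h_\#m$. The measure $\rho(x)\,\mathrm dx$ is understood on $[0,1]$. *)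

(* Defs.v *)
From HB Require Import structures.
From mathcomp Require Import all_boot all_order all_algebra all_fingroup.
From mathcomp Require Import all_classical all_reals all_analysis.
From mathcomp Require Import measurable_realfun.

Set Implicit Arguments.
Unset Strict Implicit.
Unset Printing Implicit Defensive.

Import Order.TTheory GRing.Theory Num.Theory.
Import numFieldNormedType.Exports.

Local Open Scope classical_set_scope.
Local Open Scope ring_scope.

Definition avoids321 (n : nat) (s : 'S_n) : bool :=
  ~~ [exists i : 'I_n, exists j : 'I_n, exists k : 'I_n,
       [&& (i < j)%N, (j < k)%N, (s k < s j)%N & (s j < s i)%N]].

Definition ninv (n : nat) (s : 'S_n) : nat :=
  #|[set ij : 'I_n * 'I_n | (ij.1 < ij.2)%N && (s ij.2 < s ij.1)%N]|.

Section mallows.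
Context (R : realType).

Definition mallows_weight (beta : R) (n : nat) (s : 'S_n) : R :=
  expR (beta / n%:R * (ninv s)%:R).

Definition mallows321_Z (beta : R) (n : nat) : R :=
  \sum_(s : 'S_n | avoids321 s) mallows_weight beta s.

Definition mallows321_pmf (beta : R) (n : nat) (s : 'S_n) : R :=
  if avoids321 s then mallows_weight beta s / mallows321_Z beta n else 0.

(* The first conjunct is measurability of [X] for the discrete sigma-algebra
   on the finite type ['S_n]. *)
Definition is_mallows321 (d : measure_display) (Omega : measurableType d)
    (P : probability Omega R) (beta : R) (n : nat) (X : Omega -> 'S_n) : Prop :=
  (forall s : 'S_n, measurable (X @^-1` [set s])) /\
  (forall s : 'S_n, P (X @^-1` [set s]) = (mallows321_pmf beta s)%:E).

End mallows.

Section permutons.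
Context (R : realType).
Local Notation mR := (measurableTypeR R).
Local Notation leb := (@lebesgue_measure R).

Definition unit_square : set (mR * mR) := `[0, 1] `*` `[0, 1].

(* Borel measures on the unit square are encoded as measures on [R * R] giving
   no mass to the complement of the square. *)
Definition is_permuton (mu : {measure set (mR * mR) -> \bar R}) : Prop :=
  [/\ mu setT = 1%E,
      mu (~` unit_square) = 0%E,
      forall A : set mR, measurable A -> mu (A `*` setT) = leb (A `&` `[0, 1])
    & forall A : set mR, measurable A -> mu (setT `*` A) = leb (A `&` `[0, 1])].

Definition weak_cvg (mu_ : nat -> {measure set (mR * mR) -> \bar R})
    (mu : {measure set (mR * mR) -> \bar R}) : Prop :=
  forall g : R * R -> R, {within unit_square, continuous g} ->
    (\int[mu_ n]_(z in unit_square) (g z)%:E)%E @[n --> \oo] -->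
    (\int[mu]_(z in unit_square) (g z)%:E)%E.

(* Positions and values are numbered from 0. *)
Definition cell (n i j : nat) : set (mR * mR) :=
  `[i%:R / n%:R, i.+1%:R / n%:R] `*` `[j%:R / n%:R, j.+1%:R / n%:R].

Lemma measurable_cell (n i j : nat) : measurable (cell n i j).
Proof. by apply: measurableX. Qed.

(* Mass 1/n spread uniformly over a cell of area 1/n^2, i.e. density n. *)
Definition perm_measure (n : nat) (s : 'S_n) (A : set (mR * mR)) : \bar R :=
  (\sum_(i < n) n%:R%:E * (leb \x leb)%E (A `&` cell n i (s i)))%E.

Section perm_measure_measure.
Variables (n : nat) (s : 'S_n).
Local Open Scope ereal_scope.

Let m (i : 'I_n) : {measure set (mR * mR) -> \bar R} :=
  mscale (NngNum (ler0n R n)) (mrestr (leb \x leb) (measurable_cell n i (s i))).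

Let perm_measureE A : perm_measure s A = \sum_(i < n) m i A.
Proof. by []. Qed.

Let perm_measure0 : perm_measure s set0 = 0.
Proof. by rewrite perm_measureE big1. Qed.

Let perm_measure_ge0 A : 0 <= perm_measure s A.
Proof. by rewrite perm_measureE; apply: sume_ge0. Qed.

Let perm_measure_sigma_additive : semi_sigma_additive (perm_measure s).
Proof.
move=> F mF tF mUF; rewrite [X in _ --> X](_ : _ =
    lim ((fun k => \sum_(0 <= i < k) perm_measure s (F i)) @ \oo)).
  by apply: is_cvg_ereal_nneg_natsum => k _; exact: perm_measure_ge0.
under [in RHS]eq_fun do under eq_bigr do rewrite perm_measureE.
rewrite nneseries_sum// perm_measureE; apply: eq_bigr => i _.
exact: measure_semi_bigcup.
Qed.

HB.instance Definition _ := isMeasure.Build _ _ _ (perm_measure s)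
  perm_measure0 perm_measure_ge0 perm_measure_sigma_additive.

End perm_measure_measure.

Definition permuton_cvg (s : forall n : nat, 'S_n)
    (mu : {measure set (mR * mR) -> \bar R}) : Prop :=
  weak_cvg (fun n => perm_measure (s n)) mu.

Section push.
Variables (m : {measure set mR -> \bar R}) (h : {mfun mR >-> mR}).

Definition push_graph : set (mR * mR) -> \bar R :=
  pushforward m (fun x : mR => (x, h x)).

Definition push_graphV : set (mR * mR) -> \bar R :=
  pushforward m (fun x : mR => (h x, x)).

Let mg : measurable_fun setT (fun x : mR => (x, h x)).
Proof. exact: measurable_fun_pair. Qed.

Let mgV : measurable_fun setT (fun x : mR => (h x, x)).
Proof. exact: measurable_fun_pair. Qed.

HB.instance Definition _ := Measure.copy push_graph
  (measure_function_pushforward__canonical__measure_function_Measure m mg).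

HB.instance Definition _ := Measure.copy push_graphV
  (measure_function_pushforward__canonical__measure_function_Measure m mgV).

End push.

Definition leb01 : {measure set mR -> \bar R} :=
  mrestr leb (measurable_itv `[0%R, 1%R]).

HB.instance Definition _ :=
  @isMeasurableFun.Build _ _ _ _ (@idfun mR) (@measurable_id _ _ setT).

Definition diagonal_permuton : {measure set (mR * mR) -> \bar R} :=
  push_graph leb01 (@idfun mR).

(* For beta > 0 the argument of the logarithm is positive on [0, 1], the
   support of the measures that get pushed forward; it may fail to be positive
   for larger x, where [ln] takes a default value. *)
Definition f321 (beta : R) : mR -> mR := fun x : R =>
  2^-1 + beta^-1 * ln ((expR (beta * x) + expR (beta / 2)) /
                       (1 + expR (beta / 2) + expR beta - expR (beta * x))).

Definition rho321 (beta x : R) : R := (1 + expR (beta * (2^-1 - x)))^-1.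

Lemma measurable_inv : measurable_fun setT (fun x : R => x^-1).
Proof.
rewrite -(setvU [set 0 : R]); apply/measurable_funU => //; first exact: measurableC.
split; last exact: measurable_fun_set1.
apply: open_continuous_measurable_fun.
  by apply: closed_openC; exact: closed_eq.
by move=> x /set_mem /eqP x0; exact: inv_continuous.
Qed.

Lemma measurable_f321 beta : measurable_fun setT (f321 beta).
Proof.
apply: measurable_funD => //; apply: measurable_funM => //.
apply: measurableT_comp; first exact: measurable_ln.
have me : measurable_fun setT (fun x : R => expR (beta * x)).
  by apply: measurableT_comp => //; exact: measurable_funM.
apply: measurable_funM; first exact: measurable_funD.
apply: (measurableT_comp measurable_inv).
exact: measurable_funB.
Qed.

HB.instance Definition _ beta :=
  isMeasurableFun.Build _ _ mR mR (f321 beta) (measurable_f321 beta).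

Lemma measurable_rho321 beta : measurable_fun setT (rho321 beta).
Proof.
apply: (measurableT_comp measurable_inv); apply: measurable_funD => //.
apply: measurableT_comp => //; apply: measurable_funM => //.
exact: measurable_funB.
Qed.

Lemma rho321_ge0 beta x : 0 <= rho321 beta x.
Proof. by rewrite invr_ge0 addr_ge0 ?expR_ge0. Qed.

Definition rho321_measure (beta : R) (A : set mR) : \bar R :=
  (\int[leb01]_(x in A) (rho321 beta x)%:E)%E.

Section rho321_measure_measure.
Variable beta : R.
Local Open Scope ereal_scope.

Let rho321_measure0 : rho321_measure beta set0 = 0.
Proof. exact: integral_set0. Qed.

Let rho321_measure_ge0 A : 0 <= rho321_measure beta A.
Proof. by apply: integral_ge0 => x _; rewrite lee_fin rho321_ge0. Qed.

Let rho321_measure_sigma_additive : semi_sigma_additive (rho321_measure beta).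
Proof.
apply: semi_sigma_additive_nng_induced.
  by apply/measurable_EFinP; exact: measurable_rho321.
by move=> x; rewrite lee_fin rho321_ge0.
Qed.

HB.instance Definition _ := isMeasure.Build _ _ _ (rho321_measure beta)
  rho321_measure0 rho321_measure_ge0 rho321_measure_sigma_additive.

End rho321_measure_measure.

Definition mu321 (beta : R) : {measure set (mR * mR) -> \bar R} :=
  measure_add (push_graph (rho321_measure beta) (f321 beta))
              (push_graphV (rho321_measure beta) (f321 beta)).

End permutons.

Arguments unit_square {R}.

(* Main.v *)
Require Import Defs.
From mathcomp Require Import all_boot all_order all_algebra all_fingroup.
From mathcomp Require Import all_classical all_reals all_analysis.
From mathcomp Require Import measurable_realfun.
From mathcomp Require Import zify ring lra.

(** A permutation s that avoids 321 is a union of two increasing sequences,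
carried by the set A of its excedances (the i with i < s i) and by the
complement C of A.  It is determined by A and B = s(A), and two statistics can
be read off these sets.  The number of inversions is the sum of B minus the sum
of A ([ninv_exc]).  The number of points of s in [0, k) x [0, l) is the minimum
of k, l and C(k) + B(l), where X(t) counts the elements of X below t
([hits_exc]).

The weight exp((beta / n) inv(s)) is therefore a product over the elements of A
and B.  For |A| = |B| it is proportional to the probability of the pair (C, B)
when C and B are independent random sets of the same law, each containing i
independently with probability rho((i + 1/2) / n) ([pair_weightE]).  Hence the
total weight of an event is at most its weight among independent pairs
([mallows_upper]).

A matching lower bound on the partition function holds for beta > 0.  Every pair
with |A| = |B| comes from a permutation that is increasing on A and on C; it
avoids 321 and its number of inversions is at least the sum of B minus the sum
of A.  The set A may fail to be the set of excedances, but the two agree at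
every position where the height A(t) - B(t) is positive.  Up to exponentially
small probability this height is positive away from both ends, so that few pairs
share a permutation ([mallows_lower], [low_height_small]).  The constraint
|A| = |B| costs only a factor n + 1, because |A| and |B| have the same law
([balanced_ge]).  In this way exponentially small probabilities for independent
sets become exponentially small probabilities for the Mallows permutation
([mallows_exp_small]).

Let G be the primitive of rho.  For beta > 0 the Chernoff bound concentrates
C(k) and B(l) at n G(k/n) and n G(l/n), so the distribution function of the
permuton of s is close to min(x, y, G(x) + G(y)) ([hits_concentration]), which
is the distribution function of the limit ([mu321_cdf]).

For beta <= 0 more than m inversions are at most as likely as under any
parameter b > 0 ([mallows_inv_mono]), under which inv(s) exceeds 2 b n^2 with
exponentially small probability ([inv_concentration]).  So inv(s) is o(n^2).  If
N is the number of points in [0, k) x [0, l), then (k - N)(l - N) <= inv(s),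
which forces N = min(k, l) + o(n): the limit is the diagonal
([hits_concentration_diag]).

The error probabilities are summable, whatever the coupling, so by
Borel-Cantelli the distribution functions converge almost surely at all rational
points, and this implies weak convergence ([weak_cvg_of_cdf]). *)

Set Implicit Arguments.
Unset Strict Implicit.
Unset Printing Implicit Defensive.

Import Order.TTheory GRing.Theory Num.Theory.
Import numFieldNormedType.Exports.

(** * Unions of two increasing sequences *)

Section pairs.
Variable n : nat.
Implicit Types (s : 'S_n) (A B X : {set 'I_n}).
Local Open Scope nat_scope.

Definition below X t := #|[set x in X | x < t]|.

Definition hits s k l := #|[set i : 'I_n | (i < k) && (s i < l)]|.

Definition exc s := [set i : 'I_n | i < s i].

Definition two_increasing A s :=
  [forall i, forall j, ((i \in A) == (j \in A)) && (i < j) ==> (s i < s j)].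

Lemma two_increasingP A s :
  reflect (forall i j, (i \in A) = (j \in A) -> i < j -> s i < s j)
          (two_increasing A s).
Proof.
apply: (iffP forallP) => [h i j ij lij|h i].
  by have /forallP/(_ j)/implyP := h i; apply; rewrite ij eqxx.
by apply/forallP => j; apply/implyP => /andP[/eqP]; exact: h.
Qed.

Lemma card_ord_lt k : k <= n -> #|[set i : 'I_n | i < k]| = k.
Proof.
move=> kn.
have inj : injective (widen_ord kn) by move=> a b [] /val_inj.
rewrite -[RHS]card_ord -cardsT -(card_imset _ inj).
apply: eq_card => i; rewrite !inE; apply/idP/imsetP => [ik|[j _ ->]] /=.
  by exists (Ordinal ik) => //; apply: val_inj.
exact: ltn_ord.
Qed.

Lemma card_perm_preim s (P : pred 'I_n) :
  #|[set i : 'I_n | P (s i)]| = #|[set i : 'I_n | P i]|.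
Proof.
rewrite -[LHS](card_imset _ (@perm_inj _ s)); apply: eq_card => i.
rewrite [RHS]inE; apply/imsetP/idP => [[j]|Pi]; first by rewrite inE => ? ->.
by exists (s^-1 i)%g; rewrite ?inE permKV.
Qed.

Lemma card_perm_lt s k : k <= n -> #|[set i : 'I_n | s i < k]| = k.
Proof. by move=> kn; rewrite (card_perm_preim s (fun i : 'I_n => i < k)) card_ord_lt. Qed.

Lemma avoids321P s :
  reflect (forall i j k : 'I_n, i < j -> j < k -> s k < s j -> s j < s i -> False)
          (avoids321 s).
Proof.
apply: (iffP idP) => [|h].
  move=> /existsP h i j k ij jk kj ji; apply: h.
  by exists i; apply/existsP; exists j; apply/existsP; exists k; apply/and4P.
apply/existsP => -[i /existsP[j /existsP[k /and4P[]]]]; exact: h.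
Qed.

Definition ninv_at s (i : 'I_n) := #|[set j : 'I_n | (i < j) && (s j < s i)]|.

Lemma ninvE s : ninv s = \sum_i ninv_at s i.
Proof.
rewrite /ninv.
transitivity #|[set ij : 'I_n * 'I_n | (ij.1 < ij.2) && (s ij.2 < s ij.1)]|.
  by apply: eq_card => ij; rewrite !inE; apply/asboolP/idP.
rewrite -sum1dep_card.
rewrite (eq_bigr (fun i : 'I_n => \sum_(j < n | (i < j) && (s j < s i)) 1)).
  by rewrite pair_big_dep.
by move=> i _; rewrite sum1dep_card.
Qed.

(** The values below [s i] sit to the right of i, where each makes an inversion
with i, or to its left. *)
Lemma card_split_lt s (i : 'I_n) :
  s i = ninv_at s i + #|[set j : 'I_n | (j < i) && (s j < s i)]| :> nat.
Proof.
rewrite -{1}(card_perm_lt s (ltnW (ltn_ord (s i)))) /ninv_at.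
rewrite -(cardsID [set j : 'I_n | i < j]); congr (_ + _); apply: eq_card => j;
  rewrite !inE; first by rewrite andbC.
case: (ltngtP i j) => //= /val_inj ->; by rewrite ltnn.
Qed.

Lemma ninv_at_ge s (i : 'I_n) : s i - i <= ninv_at s i.
Proof.
rewrite leq_subLR addnC {1}(card_split_lt s i) leq_add2l.
rewrite -[X in _ <= X](card_ord_lt (ltnW (ltn_ord i))).
by apply: subset_leq_card; apply/fintype.subsetP => j; rewrite !inE => /andP[].
Qed.

(** There are [s i] values below [s i] and at most i of them are to the left of
i, so at least [s i - i] inversions start at i, for every s and i. *)
Lemma ninv_ge A s : \sum_(i in A) s i <= ninv s + \sum_(i in A) i.
Proof.
rewrite ninvE (bigID (mem A) predT (ninv_at s)) /= addnAC -big_split /=.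
apply: leq_trans (leq_addr _ _); apply: leq_sum => i _.
by rewrite addnC -leq_subLR ninv_at_ge.
Qed.

Section avoiding.
Variable s : 'S_n.
Hypothesis av : avoids321 s.

(** If i starts an inversion (i, k), a j < i with [s j > s i] would give the
pattern 321 at j, i, k.  So all the i earlier values are below [s i], and so is
[s k], whence [i < s i].  The converse is [ninv_at_ge]. *)
Lemma exc_inversion (i : 'I_n) :
  (i \in exc s) = [exists j : 'I_n, (i < j) && (s j < s i)].
Proof.
have rE : [exists j : 'I_n, (i < j) && (s j < s i)] = (0 < ninv_at s i).
  apply/existsP/card_gt0P => -[j h]; exists j; first by rewrite inE.
  by move: h; rewrite inE.
rewrite rE inE; apply/idP/idP => [lt|].
  by rewrite (leq_trans _ (ninv_at_ge s i)) // subn_gt0.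
rewrite -rE => /existsP[k /andP[ik ki]].
rewrite (card_split_lt s i) -[X in X < _](card_ord_lt (ltnW (ltn_ord i))).
rewrite (_ : [set j : 'I_n | j < i] = [set j : 'I_n | (j < i) && (s j < s i)]).
  by rewrite -[X in X < _]add0n ltn_add2r -rE; apply/existsP; exists k; rewrite ik.
apply/setP => j; rewrite !inE; case: (ltnP j i) => //= ji.
rewrite ltnNge leq_eqVlt; apply/esym/negP => /orP[/eqP/val_inj/perm_inj e|sij].
  by rewrite e ltnn in ji.
exact: (avoids321P _ av j i k).
Qed.

(** By [exc_inversion] no inversion starts outside the excedances.  At an
excedance all earlier values are smaller, which turns the bound [ninv_at_ge]
into an equality. *)
Lemma ninv_exc : ninv s + \sum_(i in exc s) i = \sum_(i in exc s) s i.
Proof.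
rewrite ninvE (bigID (mem (exc s)) predT (ninv_at s)) /= [X in _ + X + _]big1 => [|i]; last first.
  rewrite exc_inversion => /existsPn h; apply/eqP; rewrite cards_eq0.
  by apply/eqP/setP => j; rewrite !inE; apply/negbTE/h.
rewrite addn0 -big_split; apply: eq_bigr => i iE /=.
rewrite [RHS](card_split_lt s i); congr (_ + _).
rewrite -[LHS](card_ord_lt (ltnW (ltn_ord i))); apply: eq_card => j.
rewrite !inE; case: (ltnP j i) => //= ji.
move: iE; rewrite exc_inversion => /existsP[k /andP[ik ki]].
apply/esym; rewrite ltnNge leq_eqVlt.
apply/negP => /orP[/eqP/val_inj/perm_inj e|sij].
  by rewrite e ltnn in ji.
exact: (avoids321P _ av j i k).
Qed.

(** A descent i < j inside one part would start an inversion at i, so both i and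
j would be excedances, and an inversion starting at j would complete a 321. *)
Lemma two_increasing_exc : two_increasing (exc s) s.
Proof.
apply/two_increasingP => i j ij lij; rewrite ltnNge leq_eqVlt.
apply/negP => /orP[/eqP/val_inj/perm_inj e|sij]; first by rewrite e ltnn in lij.
have iE : i \in exc s by rewrite exc_inversion; apply/existsP; exists j; rewrite lij.
move: (iE); rewrite ij exc_inversion => /existsP[k /andP[jk kj]].
exact: (avoids321P _ av i j k).
Qed.

End avoiding.

(** Two of the three entries of a pattern 321 would lie in the same increasing
part. *)
Lemma two_increasing_avoids A s : two_increasing A s -> avoids321 s.
Proof.
move=> /two_increasingP h; apply/avoids321P => i j k ij jk kj ji.
have lt (a b : 'I_n) : a < b -> s b < s a -> (a \in A) != (b \in A).
  by move=> ab ba; apply/eqP => /h/(_ ab); rewrite ltnNge (ltnW ba).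
have := lt _ _ ij ji; have := lt _ _ jk kj; have := lt i k (ltn_trans ij jk) (ltn_trans kj ji).
by do 3!case: (_ \in A).
Qed.

Lemma hits_le s k l : k <= n -> l <= n -> hits s k l <= minn k l.
Proof.
move=> kn ln; rewrite leq_min; apply/andP; split.
  rewrite -[X in _ <= X](card_ord_lt kn).
  by apply: subset_leq_card; apply/fintype.subsetP => j; rewrite !inE => /andP[].
rewrite -[X in _ <= X](card_perm_lt s ln).
by apply: subset_leq_card; apply/fintype.subsetP => j; rewrite !inE => /andP[].
Qed.

Lemma below_imset A s l : below (s @: A) l = #|[set i : 'I_n in A | s i < l]|.
Proof.
rewrite /below -[RHS](card_imset _ (@perm_inj _ s)); apply: eq_card => i.
rewrite !inE; apply/andP/imsetP => [[/imsetP[j jA ->] lt]|[j + ->]].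
  by exists j => //; rewrite inE jA.
by rewrite inE => /andP[jA ?]; rewrite imset_f.
Qed.

Lemma imset_setC A s : s @: (~: A) = ~: (s @: A).
Proof.
apply/setP => i; rewrite -[i](permKV s) finset.in_setC.
by rewrite !(mem_imset _ _ (@perm_inj _ s)) finset.in_setC.
Qed.

Lemma belowC X t : t <= n -> below X t + below (~: X) t = t.
Proof.
move=> tn; rewrite -[RHS](card_ord_lt tn) -(cardsID X); congr (_ + _);
  by apply: eq_card => i; rewrite !inE // andbC.
Qed.

Lemma hits_split A s k l :
  hits s k l = #|[set i : 'I_n in A | (i < k) && (s i < l)]|
               + #|[set i : 'I_n in ~: A | (i < k) && (s i < l)]|.
Proof.
rewrite /hits -(cardsID A); congr (_ + _); apply: eq_card => i; by rewrite !inE andbC.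
Qed.

(** On a set where s increases, bounding positions and bounding values both cut
out initial segments, and one of two initial segments contains the other. *)
Lemma card_nested A s k l : {in A &, forall i j : 'I_n, i < j -> s i < s j} ->
  #|[set i : 'I_n in A | (i < k) && (s i < l)]| =
  minn (below A k) #|[set i : 'I_n in A | s i < l]|.
Proof.
move=> inc; apply/eqP; rewrite eqn_leq leq_min.
apply/andP; split.
  apply/andP; split; apply: subset_leq_card; apply/fintype.subsetP => i; rewrite !inE.
    by case/and3P => -> ->.
  by case/and3P => -> _ ->.
rewrite geq_min /below.
have [sub|/fintype.subsetPn[i]] := boolP
  ([set i : 'I_n in A | i < k] \subset [set i : 'I_n in A | s i < l]).
  apply/orP; left; apply: subset_leq_card; apply/fintype.subsetP => i iA.
  have := fintype.subsetP sub _ iA; move: iA; rewrite !inE => /andP[-> ->] /andP[_ ->] //.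
rewrite !inE => /andP[iA ik]; rewrite iA /= -leqNgt => li.
apply/orP; right; apply: subset_leq_card; apply/fintype.subsetP => j.
rewrite !inE => /andP[jA jl]; rewrite jA jl andbT /=.
rewrite ltnNge; apply/negP => kj.
have ij : i < j by apply: leq_trans kj.
by have := inc i j iA jA ij; lia.
Qed.

(** Each part of s contributes a minimum by [card_nested].  For k <= l the
condition [s i < l] is automatic for the i < k that are not excedances, and for
l <= k the condition i < k is automatic for the excedances with [s i < l], so
one of the two minima is resolved in each case. *)
Lemma hits_exc s k l : avoids321 s -> k <= n -> l <= n ->
  hits s k l = minn (minn k l) (below (~: exc s) k + below (s @: exc s) l).
Proof.
move=> av kn ln; have /two_increasingP inc := two_increasing_exc av.
have incA : {in exc s &, forall i j : 'I_n, i < j -> s i < s j}.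
  by move=> i j iA jA; apply: inc; rewrite iA jA.
have incC : {in ~: exc s &, forall i j : 'I_n, i < j -> s i < s j}.
  by move=> i j; rewrite !finset.in_setC => /negbTE iA /negbTE jA; apply: inc; rewrite iA jA.
have := belowC (exc s) kn; have := belowC (s @: exc s) ln.
have eB : below (s @: exc s) l = #|[set i : 'I_n in exc s | s i < l]| by exact: below_imset.
have eBC : below (~: (s @: exc s)) l = #|[set i : 'I_n in ~: exc s | s i < l]|.
  by rewrite -below_imset imset_setC.
rewrite (hits_split (exc s)) !card_nested // -eB -eBC => h1 h2.
have [kl|/ltnW lk] := leqP k l.
  have : below (~: exc s) k <= below (~: (s @: exc s)) l.
    rewrite eBC; apply: subset_leq_card; apply/fintype.subsetP => i; rewrite !inE -leqNgt.
    by case/andP => si ik; rewrite si; lia.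
  move: h1 h2; set a := below (exc s) k; set b := below (~: exc s) k;
  set c := below (s @: exc s) l; set e := below (~: (s @: exc s)) l.
  lia.
have : below (s @: exc s) l <= below (exc s) k.
  rewrite eB; apply: subset_leq_card; apply/fintype.subsetP => i; rewrite !inE.
  by case/andP => si ik; rewrite si; lia.
move: h1 h2; set a := below (exc s) k; set b := below (~: exc s) k;
set c := below (s @: exc s) l; set e := below (~: (s @: exc s)) l.
lia.
Qed.

(** A point of s in [0, k) x [l, n) and a point in [k, n) x [0, l) always form an
inversion. *)
Lemma ninv_hits s k l : k <= n -> l <= n ->
  (k - hits s k l) * (l - hits s k l) <= ninv s.
Proof.
move=> kn ln.
have -> : k - hits s k l = #|[set i : 'I_n | (i < k) && (l <= s i)]|.
  rewrite -{1}(card_ord_lt kn) -(cardsID [set i : 'I_n | s i < l]) /hits.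
  rewrite (_ : _ :&: _ = [set i : 'I_n | (i < k) && (s i < l)]); last first.
    by apply/setP => i; rewrite !inE.
  by rewrite addnC addnK; apply: eq_card => i; rewrite !inE -leqNgt andbC.
have -> : l - hits s k l = #|[set i : 'I_n | (k <= i) && (s i < l)]|.
  rewrite -{1}(card_perm_lt s ln) -(cardsID [set i : 'I_n | i < k]) /hits.
  rewrite (_ : _ :&: _ = [set i : 'I_n | (i < k) && (s i < l)]); last first.
    by apply/setP => i; rewrite !inE andbC.
  by rewrite addnC addnK; apply: eq_card => i; rewrite !inE -leqNgt.
rewrite -cardsX /ninv; apply: subset_leq_card; apply/fintype.subsetP => -[i j].
rewrite !inE /= => /andP[/andP[ik li] /andP[kj jl]].
apply/asboolP; rewrite /= (leq_trans ik kj) (leq_trans jl li); exact/asboolP.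
Qed.

(** The hypothesis says that the lattice path going up at the elements of A and
down at those of [s @: A] is above 0 after step i.  As s is increasing on A, an
i in A whose image is at most i would bring all the elements of A up to i to
values up to i.  The case of i outside A is the same statement for the
complements, whose counts compare the other way. *)
Lemma exc_of_height A s (i : 'I_n) : two_increasing A s ->
  below (s @: A) i.+1 < below A i.+1 -> (i \in A) = (i < s i).
Proof.
move=> /two_increasingP inc; rewrite below_imset => lt.
apply/idP/idP => [iA|lti].
  rewrite ltnNge; apply/negP => le.
  move: lt; rewrite ltnNge => /negP; apply.
  apply: subset_leq_card; apply/fintype.subsetP => j; rewrite !inE => /andP[jA].
  rewrite jA ltnS leq_eqVlt => /orP[/eqP/val_inj ->|ji] //.
  by have := inc j i; rewrite iA jA => /(_ erefl ji); lia.
apply/negPn/negP => iA.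
have := belowC A (ltn_ord i); have := belowC (s @: A) (ltn_ord i).
have -> : below (~: (s @: A)) i.+1 = #|[set i0 : 'I_n in ~: A | s i0 < i.+1]|.
  by rewrite -below_imset imset_setC.
rewrite below_imset.
have : #|[set i0 : 'I_n in ~: A | s i0 < i.+1]| <= below (~: A) i.+1.
  apply: subset_leq_card; apply/fintype.subsetP => j; rewrite !inE => /andP[jA sj].
  rewrite jA /= ltnNge; apply/negP => ij.
  by have := inc i j; rewrite (negbTE iA) (negbTE jA) => /(_ erefl ij); lia.
lia.
Qed.

(** On a part where s increases, an element and its image have the same rank,
measured by [below], in the part and in its image; ranks determine elements. *)
Lemma two_increasing_uniq A s t :
  two_increasing A s -> two_increasing A t -> s @: A = t @: A -> s = t.
Proof.
move=> /two_increasingP incs /two_increasingP inct st.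
suff H (X : {set 'I_n}) : (forall i j : 'I_n, i \in X -> j \in X -> i < j -> s i < s j) ->
    (forall i j : 'I_n, i \in X -> j \in X -> i < j -> t i < t j) -> s @: X = t @: X ->
    {in X, s =1 t}.
  have HA : {in A, s =1 t}.
    by apply: H => // i j iA jA; [apply: incs|apply: inct]; rewrite iA jA.
  have HC : {in ~: A, s =1 t}.
    apply: H.
    - by move=> i j; rewrite !inE => /negbTE iA /negbTE jA; apply: incs; rewrite iA jA.
    - by move=> i j; rewrite !inE => /negbTE iA /negbTE jA; apply: inct; rewrite iA jA.
    - by rewrite !imset_setC st.
  apply/permP => i; have [/HA//|iA] := boolP (i \in A).
  by apply: HC; rewrite inE.
move=> is_ it stX i iX.
have cnt (u : 'S_n) : (forall i j : 'I_n, i \in X -> j \in X -> i < j -> u i < u j) ->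
    below (u @: X) (u i) = below X i.
  move=> iu; rewrite below_imset; apply: eq_card => j; rewrite !inE.
  have [jX|//] := boolP (j \in X) => /=.
  case: (ltngtP j i) => [ji|ij|/val_inj ->]; last by rewrite ltnn.
    exact: iu.
  by apply/negbTE; rewrite -leqNgt ltnW //; exact: iu.
have mono (Y : {set 'I_n}) (a b : 'I_n) : a \in Y -> a < b -> below Y a < below Y b.
  move=> aY ab; apply: proper_card; apply/properP; split.
    by apply/fintype.subsetP => j; rewrite !inE => /andP[->] /ltn_trans -> //.
  by exists a; rewrite !inE aY ?ab // ltnn.
have e := etrans (cnt s is_) (esym (cnt t it)); rewrite -stX in e.
have siX : s i \in s @: X by rewrite imset_f.
have tiX : t i \in s @: X by rewrite stX imset_f.
case: (ltngtP (s i) (t i)) => [lt|lt|/val_inj //].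
  by have := mono _ _ _ siX lt; rewrite e ltnn.
by have := mono _ _ _ tiX lt; rewrite e ltnn.
Qed.

(** Match the elements of A and B of equal rank, and likewise for the
complements. *)
Lemma two_increasing_exists A B : #|A| = #|B| ->
  exists2 s, two_increasing A s & s @: A = B.
Proof.
move=> AB.
have ABC : #|~: A| = #|~: B| by rewrite [LHS]cardsCs [RHS]cardsCs !finset.setCK AB.
pose r : rel 'I_n := relpre val ltn.
have tr : transitive r by move=> a b c; exact: ltn_trans.
have srt (X : {set 'I_n}) : sorted r (enum X).
  rewrite /enum_mem; apply: (sorted_filter tr); rewrite -enumT.
  by rewrite /r -sorted_map val_enum_ord iota_ltn_sorted.
pose g (X Y : {set 'I_n}) (i : 'I_n) := nth i (enum Y) (index i (enum X)).
have gin (X Y : {set 'I_n}) i : #|X| = #|Y| -> i \in X -> g X Y i \in Y.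
  move=> XY iX; rewrite -mem_enum mem_nth //.
  by rewrite -cardE -XY cardE index_mem mem_enum.
have ginc (X Y : {set 'I_n}) (i j : 'I_n) : #|X| = #|Y| -> i \in X -> j \in X -> (i < j)%N ->
    (g X Y i < g X Y j)%N.
  move=> XY iX jX ij; rewrite /g (set_nth_default j).
    2: by rewrite -cardE -XY cardE index_mem mem_enum.
  apply: (sorted_ltn_nth tr j (srt Y)).
  - by rewrite inE -cardE -XY cardE index_mem mem_enum.
  - by rewrite inE -cardE -XY cardE index_mem mem_enum.
  rewrite ltnNge leq_eqVlt; apply/negP => /orP[/eqP e|lt].
    have : nth i (enum X) (index j (enum X)) = i by rewrite e nth_index // mem_enum.
    by rewrite nth_index ?mem_enum // => e'; rewrite e' ltnn in ij.
  have := sorted_ltn_index tr (srt X); move/(_ j i).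
  by rewrite !mem_enum => /(_ jX iX lt); rewrite /r /=; lia.
pose f i := if i \in A then g A B i else g (~: A) (~: B) i.
have fB i : (f i \in B) = (i \in A).
  rewrite /f; case: ifP => iA; first by rewrite gin.
  by apply/negbTE; rewrite -finset.in_setC gin // finset.in_setC iA.
have finc (i j : 'I_n) : (i \in A) = (j \in A) -> (i < j)%N -> (f i < f j)%N.
  rewrite /f => e; rewrite -e; case: ifP => iA ij.
    by apply: ginc => //; rewrite -e.
  by apply: ginc => //; rewrite inE ?iA -?e ?iA.
have finj : injective f.
  move=> i j e; have eA : (i \in A) = (j \in A) by rewrite -!fB e.
  case: (ltngtP i j) => [ij|ji|/val_inj //].
    by have := finc _ _ eA ij; rewrite e ltnn.
  by have := finc _ _ (esym eA) ji; rewrite e ltnn.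
exists (perm finj).
  by apply/two_increasingP => i j; rewrite !permE; exact: finc.
apply/eqP; rewrite eqEcard card_imset ?AB ?leqnn ?andbT; last exact: perm_inj.
by apply/fintype.subsetP => _ /imsetP[i iA ->]; rewrite permE fB.
Qed.

End pairs.

Local Open Scope ring_scope.

(** * Chernoff bound for independent bits *)

(** From exp(-x) >= 1 - x and (1 - x)(1 + x + 2 x^2) = 1 + x^2 (1 - 2 x) >= 1. *)
Lemma expR_le_quad (R : realType) (x : R) :
  `|x| <= 2^-1 -> expR x <= 1 + x + 2 * x ^+ 2.
Proof.
rewrite ler_norml => /andP[lx ux].
have h : 0 < 1 - x by lra.
have e : expR x <= (1 - x)^-1.
  rewrite -[expR x]invrK lef_pV2 ?posrE ?invr_gt0 ?expR_gt0 //.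
  by rewrite -expRN; have := expR_ge1Dx (- x); lra.
apply: (le_trans e); rewrite -[leLHS]mul1r ler_pdivrMr //.
have : 0 <= x ^+ 2 * (1 - 2 * x) by rewrite mulr_ge0 ?sqr_ge0 //; lra.
lra.
Qed.

Section bernoulli.
Context (R : realType) (n : nat).
Implicit Types (p c : 'I_n -> R) (X : {set 'I_n}).
Let pair := ({set 'I_n} * {set 'I_n})%type.

(** The product Bernoulli law on subsets; [bern2] is the law of two independent
subsets. *)
Definition bern p X : R := \prod_i (if i \in X then p i else 1 - p i).

Definition bern2 p (E : pred pair) : R := \sum_(q | E q) bern p q.1 * bern p q.2.

Variable p : 'I_n -> R.
Hypothesis p01 : forall i, 0 <= p i <= 1.

Lemma bern_ge0 X : 0 <= bern p X.
Proof.
apply: prodr_ge0 => i _; have /andP[] := p01 i.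
by case: ifP => _; rewrite ?subr_ge0.
Qed.

Lemma bern_total : \sum_X bern p X = 1.
Proof.
transitivity (\prod_(i < n) (p i + (1 - p i))).
  by rewrite bigA_distr.
by rewrite big1 // => i _; rewrite addrC subrK.
Qed.

Lemma bern2_ge0 E : 0 <= bern2 p E.
Proof. by apply: sumr_ge0 => q _; rewrite mulr_ge0 ?bern_ge0. Qed.

Lemma bern2_le (E F : pred pair) : {subset E <= F} -> bern2 p E <= bern2 p F.
Proof.
move=> EF; rewrite /bern2 [leRHS](bigID E) /=.
rewrite [X in _ <= X + _](eq_bigl E) => [|q].
  by rewrite lerDl; apply: sumr_ge0 => q _; rewrite mulr_ge0 ?bern_ge0.
by case Eq : (E q); rewrite ?andbF // andbT; exact: EF.
Qed.

Lemma bern2_union (I : finType) (A : pred I) (E : I -> pred pair) :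
  bern2 p [pred q | [exists i, A i && E i q]] <= \sum_(i | A i) bern2 p (E i).
Proof.
rewrite /bern2 [leRHS](exchange_big_dep predT) //=.
rewrite [leRHS](bigID [pred q | [exists i, A i && E i q]]) /=.
rewrite -[leLHS]addr0; apply: lerD; last first.
  by apply: sumr_ge0 => q _; apply: sumr_ge0 => i _; rewrite mulr_ge0 ?bern_ge0.
apply: ler_sum => q /existsP[i /andP[Ai Ei]].
rewrite (bigD1 i) ?Ai // lerDl.
by apply: sumr_ge0 => j _; rewrite mulr_ge0 ?bern_ge0.
Qed.

(** Linear statistics of a random subset, centred under [bern p]. *)
Definition dev c X : R := \sum_i c i * ((i \in X)%:R - p i).

(** The exponential moment factors over i.  In each factor the linear terms of
[expR_le_quad] cancel by centring and the quadratic ones are bounded by the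
variance. *)
Lemma bern_mgf c (l : R) : (forall i, `|c i| <= 1) -> 0 <= l <= 2^-1 ->
  \sum_X bern p X * expR (l * dev c X) <= expR (2 * l ^+ 2 * n%:R).
Proof.
move=> c1 /andP[l0 l1].
apply: (@le_trans _ _ (\prod_(i < n) (p i * expR (l * (c i * (1 - p i)))
                             + (1 - p i) * expR (l * (c i * (- p i)))))).
  rewrite bigA_distr le_eqVlt; apply/orP; left; apply/eqP.
  apply: eq_bigr => X _; rewrite /bern /dev mulr_sumr expR_sum -big_split /=.
  by apply: eq_bigr => i _; case: ifP => _ //=; rewrite sub0r.
rewrite (_ : n%:R = \sum_(i < n) 1); last by rewrite sumr_const card_ord.
rewrite mulr_sumr expR_sum; apply: ler_prod => i _.
have /andP[p0 p1] := p01 i.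
have := c1 i; rewrite ler_norml => /andP[c0 c1'].
rewrite addr_ge0 ?mulr_ge0 ?expR_ge0 ?subr_ge0 //=.
have lc : `|l * c i| <= 2^-1 by rewrite normrM ger0_norm //; have := c1 i; nra.
have q1 : `|l * (c i * (1 - p i))| <= 2^-1.
  rewrite mulrA normrM (ger0_norm (_ : 0 <= 1 - p i)) ?subr_ge0 //.
  by have := normr_ge0 (l * c i); nra.
have q2 : `|l * (c i * - p i)| <= 2^-1.
  rewrite mulrA normrM normrN (ger0_norm p0).
  by have := normr_ge0 (l * c i); nra.
rewrite mulr1.
have e : 1 + 2 * l ^+ 2 <= expR (2 * l ^+ 2) by exact: expR_ge1Dx.
apply: le_trans e.
have := ler_wpM2l p0 (expR_le_quad q1).
have := ler_wpM2l (_ : 0 <= 1 - p i) (expR_le_quad q2).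
rewrite subr_ge0 => /(_ p1).
set e1 := expR _; set e2 := expR _ => h1 h2.
apply: (le_trans (lerD h2 h1)).
have : c i ^+ 2 * (p i * (1 - p i)) <= 1.
  have -> : c i ^+ 2 = `|c i| ^+ 2 by rewrite real_normK ?num_real.
  have := c1 i; have := normr_ge0 (c i); move: `|c i| => k k0 k1.
  have : k ^+ 2 <= 1 by nra.
  have : 0 <= k ^+ 2 by nra.
  have : 0 <= p i * (1 - p i) <= 1 by nra.
  nra.
have : 0 <= l ^+ 2 by nra.
nra.
Qed.

(** Markov's inequality for the exponential of l times the sum of both
statistics; l = r / 8 minimises the resulting exponent 4 l^2 - l r. *)
Lemma bern2_chernoff c d (r : R) : (forall i, `|c i| <= 1) ->
  (forall i, `|d i| <= 1) -> 0 <= r <= 1 ->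
  bern2 p [pred q : pair | r * n%:R <= dev c q.1 + dev d q.2]
  <= expR (- (r ^+ 2 / 16) * n%:R).
Proof.
move=> c1 d1 /andP[r0 r1]; pose l := r / 8.
have l01 : 0 <= l <= 2^-1 by rewrite /l; lra.
have l0 : 0 <= l by case/andP: l01.
apply: (@le_trans _ _ (expR (- (l * r * n%:R)) *
   \sum_(q : pair) (bern p q.1 * expR (l * dev c q.1)) *
                   (bern p q.2 * expR (l * dev d q.2)))).
  rewrite mulr_sumr [leRHS](bigID [pred q : pair | r * n%:R <= dev c q.1 + dev d q.2]) /=.
  rewrite -[leLHS]addr0; apply: lerD; last first.
    by apply: sumr_ge0 => q _; rewrite !mulr_ge0 ?expR_ge0 ?bern_ge0.
  apply: ler_sum => q hq.
  have -> (x y z w t : R) : x * ((y * z) * (w * t)) = (y * w) * (x * (z * t)) by ring.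
  rewrite ler_peMr ?mulr_ge0 ?bern_ge0 // -!expRD -[leLHS]expR0 ler_expR.
  by have := ler_wpM2l l0 hq; rewrite mulrDr mulrA => h; rewrite addrC subr_ge0.
rewrite -(pair_bigA _ (fun X Y => (bern p X * expR (l * dev c X)) *
                   (bern p Y * expR (l * dev d Y)))) /=.
under eq_bigr do rewrite -mulr_sumr.
rewrite -mulr_suml.
have h := ler_pM _ _ (bern_mgf c1 l01) (bern_mgf d1 l01).
apply: (@le_trans _ _ (expR (- (l * r * n%:R)) *
    (expR (2 * l ^+ 2 * n%:R) * expR (2 * l ^+ 2 * n%:R)))).
  rewrite ler_wpM2l ?expR_ge0 // h //.
    by apply: sumr_ge0 => q _; rewrite !mulr_ge0 ?expR_ge0 ?bern_ge0.
  by apply: sumr_ge0 => q _; rewrite !mulr_ge0 ?expR_ge0 ?bern_ge0.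
by rewrite -!expRD ler_expR /l; rewrite le_eqVlt; apply/orP; left; apply/eqP; field.
Qed.

End bernoulli.

(** * Mallows weights and independent pairs of sets *)

Section gibbs.
Context (R : realType) (beta : R) (n : nat).
Implicit Types (s : 'S_n) (A B C M : {set 'I_n}).
Let pair := ({set 'I_n} * {set 'I_n})%type.

(** The shift by 1/2 samples the density at the midpoint of the i-th cell, which
makes the symmetry [siteprob_rev] exact. *)
Definition siteprob (i : 'I_n) : R := rho321 beta ((i%:R + 2^-1) / n%:R).

Lemma siteprob01 i : 0 <= siteprob i <= 1.
Proof.
rewrite /siteprob rho321_ge0 /rho321 invf_le1 ?ltr_wpDr ?expR_ge0 //.
by rewrite lerDl expR_ge0.
Qed.

Let u (i : 'I_n) : R := beta * ((i%:R + 2^-1) / n%:R - 2^-1).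

Lemma siteprob_odds i : (1 + expR (u i)) * siteprob i = expR (u i) /\
  (1 + expR (- u i)) * siteprob i = 1.
Proof.
have -> : siteprob i = (1 + expR (- u i))^-1.
  by rewrite /siteprob /rho321 /u; congr ((1 + expR _)^-1); ring.
have h := expR_gt0 (u i); rewrite expRN; split; field.
all: by rewrite ?gt_eqF //; have := expR_gt0 (u i); lra.
Qed.

Definition pair_weight A B : R :=
  expR (beta / n%:R * (\sum_(i in B) i%:R - \sum_(i in A) i%:R)).

Definition bern_const : R := \prod_(i < n) ((1 + expR (u i)) * (1 + expR (- u i))).

Lemma bern_const_gt0 : 0 < bern_const.
Proof. by apply: prodr_gt0 => i _; rewrite mulr_gt0 ?ltr_wpDr ?expR_ge0. Qed.

(** The weight is a product of odds [expR (u i)] over B and [expR (- u i)] over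
A, the constant part of u cancelling because |A| = |B|.  Inverse odds for A are
odds for its complement, so [~: A] and B get the same law. *)
Lemma pair_weightE A B : #|A| = #|B| ->
  pair_weight A B = bern_const * (bern siteprob (~: A) * bern siteprob B).
Proof.
move=> AB; rewrite /bern_const /bern -!big_split /=.
transitivity (\prod_(i < n) ((if i \in B then expR (u i) else 1)
                             * (if i \in A then expR (- u i) else 1))).
  rewrite big_split -!big_mkcond -!expR_sum /= -expRD /pair_weight; congr expR.
  have e (X : {set 'I_n}) : \sum_(i in X) u i =
      beta / n%:R * \sum_(i in X) i%:R + #|X|%:R * (beta / n%:R * 2^-1 - beta * 2^-1).
    rewrite -sum1_card natr_sum mulr_suml mulr_sumr -big_split /=.
    by apply: eq_bigr => i _; rewrite /u; ring.
  by rewrite sumrN !e AB; ring.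
apply: eq_bigr => i _; have [e1 e2] := siteprob_odds i; rewrite !inE.
have e1' : (1 + expR (u i)) * (1 - siteprob i) = 1 by rewrite mulrBr e1; ring.
have e2' : (1 + expR (- u i)) * (1 - siteprob i) = expR (- u i) by rewrite mulrBr e2; ring.
have -> (a b c d : R) : a * b * (c * d) = (a * d) * (b * c) by ring.
by case: (i \in A); case: (i \in B) => /=; rewrite ?e1 ?e1' ?e2 ?e2'.
Qed.

Definition pair_of s : pair := (~: exc s, s @: exc s).

Lemma mallows_weight_exc s : avoids321 s ->
  mallows_weight beta s =
  bern_const * (bern siteprob (pair_of s).1 * bern siteprob (pair_of s).2).
Proof.
move=> av; rewrite -pair_weightE ?card_imset //; last exact: perm_inj.
rewrite /mallows_weight /pair_weight big_imset /=; last by move=> i j _ _; exact: perm_inj.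
have := congr1 (fun k : nat => k%:R : R) (ninv_exc av).
by rewrite natrD !natr_sum => <-; rewrite addrK.
Qed.

Lemma pair_of_inj : {in @avoids321 n &, injective pair_of}.
Proof.
move=> s t avs avt [/(congr1 (@finset.setC _))]; rewrite !finset.setCK => e1 e2.
apply: (@two_increasing_uniq n (exc s)); first exact: two_increasing_exc.
  by rewrite e1; exact: two_increasing_exc.
by rewrite e2 e1.
Qed.

(** [pair_of] is injective on avoiding permutations and matches the weights, so
this only adds nonnegative terms. *)
Lemma mallows_upper (E : pred 'S_n) (F : pred pair) :
  (forall s, avoids321 s -> E s -> F (pair_of s)) ->
  \sum_(s | avoids321 s && E s) mallows_weight beta s <=
  bern_const * bern2 siteprob F.
Proof.
move=> EF; rewrite /bern2 mulr_sumr.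
pose S := [set s : 'S_n | avoids321 s && E s].
under eq_bigr => s /andP[av _] do rewrite mallows_weight_exc //.
rewrite (eq_bigl (mem S)) => [|s]; last by rewrite !inE.
rewrite -(@big_imset _ _ _ _ _ pair_of S
  (fun q => bern_const * (bern siteprob q.1 * bern siteprob q.2))) /=; last first.
  by move=> s t; rewrite !inE => /andP[? _] /andP[? _]; exact: pair_of_inj.
rewrite [leRHS](bigID (mem (pair_of @: S))) /=.
rewrite [X in _ <= X + _](eq_bigl (mem (pair_of @: S))) => [|q].
  rewrite lerDl; apply: sumr_ge0 => q _; rewrite mulr_ge0 ?(ltW bern_const_gt0) //.
  by rewrite mulr_ge0 // bern_ge0 //; exact: siteprob01.
apply/andP/idP => [[] //|qS]; split => //.
by case/imsetP: qS => s; rewrite !inE => /andP[av Es] ->; exact: EF.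
Qed.

(** The pair (C, B) stands for the sets A = [~: C] and B.  Since A has
[i.+1 - below C i.+1] elements below [i.+1], the inequality says that the height
is positive after step i. *)
Definition admissible M : pred pair := fun q =>
  (#|q.1| + #|q.2| == n)%N &&
  [forall i in M, (below q.1 i.+1 + below q.2 i.+1 < i.+1)%N].

(** Send (C, B) to the permutation matching A = [~: C] with B, together with the
trace of A outside M.  By [exc_of_height] the permutation gives back A on M, so
this map is injective, and each permutation is hit at most [2 ^ #|~: M|] times.
By [ninv_ge] the weight of the permutation dominates that of the pair; this uses
[0 <= beta]. *)
Lemma mallows_lower M : 0 <= beta ->
  bern_const * bern2 siteprob (admissible M) <= 2 ^+ #|~: M| * mallows321_Z beta n.
Proof.
move=> beta0.
pose good q s := two_increasing (~: q.1) s && (s @: (~: q.1) == q.2).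
pose perm_of (q : pair) : 'S_n := odflt 1%g [pick s | good q s].
have card_adm q : admissible M q -> #|~: q.1| = #|q.2|.
  case/andP => /eqP e _; apply: (@addnI #|q.1|).
  by rewrite cardsC card_ord.
have perm_ofP q : admissible M q -> good q (perm_of q).
  move=> /card_adm /two_increasing_exists[s inc e]; rewrite /perm_of.
  by case: pickP => //= /(_ s); rewrite /good inc e eqxx.
(* the trace outside M separates the pairs with the same permutation *)
pose phi (q : pair) := (perm_of q, ~: q.1 :\: M).
pose G (x : 'S_n * {set 'I_n}) := mallows_weight beta x.1.
have phi_inj : {in admissible M &, injective phi}.
  move=> q q' aq aq' [e1 e2].
  have /andP[inc /eqP im] := perm_ofP _ aq.
  have /andP[inc' /eqP im'] := perm_ofP _ aq'.
  have key (x : pair) i : admissible M x -> i \in M -> good x (perm_of x) ->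
      (i \in ~: x.1) = (i < perm_of x i)%N.
    move=> ax iM /andP[incx /eqP imx]; apply: exc_of_height => //.
    rewrite imx; case/andP: ax => _ /forallP/(_ i)/implyP/(_ iM).
    by rewrite -[X in (_ < X)%N](belowC x.1 (ltn_ord i)) ltn_add2l.
  have e : ~: q.1 = ~: q'.1.
    apply/setP => i; have [iM|iM] := boolP (i \in M).
      by rewrite (key _ _ aq iM (perm_ofP _ aq)) (key _ _ aq' iM (perm_ofP _ aq')) e1.
    by have := congr1 (fun X : {set 'I_n} => i \in X) e2; rewrite !finset.in_setD iM.
  have f : q.1 = q'.1 by rewrite -[q.1]finset.setCK e finset.setCK.
  have g : q.2 = q'.2 by rewrite -im -im' e1 f.
  by case: (q) (q') f g => a b [c d] /= -> ->.
pose S := [set q : pair | admissible M q].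
pose W := [set x : 'S_n * {set 'I_n} | avoids321 x.1 & x.2 \subset ~: M].
apply: (@le_trans _ _ (\sum_(x in phi @: S) G x)).
  rewrite big_imset /=; last by move=> q q'; rewrite !inE; exact: phi_inj.
  rewrite /bern2 mulr_sumr [leRHS](eq_bigl (admissible M)) => [|q]; last by rewrite inE.
  apply: ler_sum => q aq; rewrite -{1}[q.1]finset.setCK -pair_weightE ?card_adm //.
  rewrite /G /phi /= /pair_weight /mallows_weight ler_expR.
  rewrite ler_wpM2l ?divr_ge0 //.
  have /andP[_ /eqP <-] := perm_ofP _ aq.
  rewrite big_imset /=; last by move=> i j _ _; exact: perm_inj.
  by rewrite lerBlDr -!natr_sum -natrD ler_nat ninv_ge.
apply: (@le_trans _ _ (\sum_(x in W) G x)).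
  rewrite [leRHS](bigID (mem (phi @: S))) /=.
  rewrite [X in _ <= X + _](eq_bigl (mem (phi @: S))) => [|x].
    by rewrite lerDl; apply: sumr_ge0 => x _; exact: expR_ge0.
  apply/andP/idP => [[] //|xS]; split => //.
  case/imsetP: xS => q; rewrite inE => aq ->; rewrite !inE /=.
  have /andP[inc _] := perm_ofP _ aq.
  by rewrite (two_increasing_avoids inc) finset.setDE finset.subsetIr.
rewrite (eq_bigl (fun x : 'S_n * {set 'I_n} =>
    avoids321 x.1 && (x.2 \in powerset (~: M)))).
  rewrite -(pair_big (@avoids321 n) (mem (powerset (~: M)))
    (fun s _ => mallows_weight beta s)) /=.
  under eq_bigr do rewrite sumr_const card_powerset -mulr_natl natrX.
  by rewrite -mulr_sumr.
by move=> x; rewrite !inE.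
Qed.

End gibbs.

Section ratio.
Context (R : realType) (beta : R) (n : nat).
Hypothesis n0 : (0 < n)%N.
Implicit Types (s : 'S_n) (A B C M : {set 'I_n}).
Let pair := ({set 'I_n} * {set 'I_n})%type.
Local Notation p := (@siteprob R beta n).

Lemma rho321_sym x : rho321 beta (1 - x) = 1 - rho321 beta x.
Proof.
rewrite /rho321 (_ : beta * (2^-1 - (1 - x)) = - (beta * (2^-1 - x))); last by field.
rewrite expRN; have := expR_gt0 (beta * (2^-1 - x)); set e := expR _ => e0.
by field; rewrite ?gt_eqF //; lra.
Qed.

Lemma siteprob_rev i : p (rev_ord i) = 1 - p i.
Proof.
rewrite /siteprob -rho321_sym; congr rho321.
have nE : (n%:R : R) != 0 by rewrite pnatr_eq0 -lt0n.
by rewrite /= natrB // -natr1; field.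
Qed.

(** Expand the sum of the squares of the distances to the uniform law. *)
Lemma cauchy_uniform (m : nat) (r : 'I_m.+1 -> R) :
  \sum_k r k = 1 -> m.+1%:R^-1 <= \sum_k r k ^+ 2.
Proof.
move=> r1; have m0 : (m.+1%:R : R) != 0 by rewrite pnatr_eq0.
pose c : R := m.+1%:R^-1.
have : 0 <= \sum_k (r k - c) ^+ 2 by apply: sumr_ge0 => k _; exact: sqr_ge0.
have -> : \sum_k (r k - c) ^+ 2 =
    \sum_k r k ^+ 2 - 2 * c * \sum_k r k + \sum_(k < m.+1) c ^+ 2.
  by rewrite mulr_sumr -sumrB -big_split /=; apply: eq_bigr => k _; ring.
have -> : \sum_(k < m.+1) c ^+ 2 = c.
  by rewrite sumr_const card_ord -[LHS]mulr_natl /c; field.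
rewrite r1.
by rewrite -/c; lra.
Qed.

(** Reversing positions and taking complements both change p into 1 - p, so
doing both preserves the law. *)
Definition flip A := ~: (@rev_ord n @: A).

Lemma flipK : involutive flip.
Proof.
have e A i : (i \in flip A) = (rev_ord i \notin A).
  by rewrite finset.in_setC -{1}[i]rev_ordK mem_imset //; exact: rev_ord_inj.
by move=> A; apply/setP => i; rewrite !e rev_ordK negbK.
Qed.

Lemma card_flip A : (#|flip A| + #|A| = n)%N.
Proof.
rewrite /flip cardsCs finset.setCK card_ord card_imset ?subnK //; last exact: rev_ord_inj.
by rewrite -[leqRHS]card_ord max_card.
Qed.

Lemma bern_flip A : bern p (flip A) = bern p A.
Proof.
rewrite /bern [LHS](reindex_inj rev_ord_inj) /=; apply: eq_bigr => i _.
rewrite /flip inE mem_imset; last exact: rev_ord_inj.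
by rewrite siteprob_rev; case: (i \in A) => //=; ring.
Qed.

(** After flipping the first set the event says that two independent sets of the
same law have equally many elements, and two independent variables of the same
law on n + 1 values coincide with probability at least 1 / (n + 1). *)
Lemma balanced_ge : n.+1%:R^-1 <= bern2 p [pred q : pair | #|q.1| + #|q.2| == n]%N.
Proof.
pose r (k : 'I_n.+1) : R := \sum_(B : {set 'I_n} | #|B| == k :> nat) bern p B.
have cardn (B : {set 'I_n}) : (#|B| < n.+1)%N by rewrite ltnS -[leqRHS]card_ord max_card.
have r1 : \sum_k r k = 1.
  rewrite -(bern_total p) (partition_big (fun B : {set 'I_n} => Ordinal (cardn B)) predT) //=.
apply: le_trans (cauchy_uniform r1) _.
rewrite le_eqVlt; apply/orP; left; apply/eqP; rewrite /bern2.
rewrite -(pair_big_dep predT (fun C B : {set 'I_n} => #|C| + #|B| == n)%N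
  (fun C B => bern p C * bern p B)) /=.
rewrite (reindex_inj (inv_inj flipK)) /=.
rewrite (partition_big (fun B : {set 'I_n} => Ordinal (cardn B)) predT) //=.
apply: eq_bigr => k _; rewrite expr2 {1}/r mulr_suml.
apply: eq_bigr => A /eqP kA; rewrite bern_flip mulr_sumr.
apply: eq_bigl => B; move: (card_flip A); rewrite kA => h.
apply/eqP/eqP => [->|]; first exact: h.
by rewrite -[RHS]h => /addnI.
Qed.

Definition mallows_prob (E : pred 'S_n) : R := \sum_(s | E s) mallows321_pmf beta s.

Lemma mallows321_Z_gt0 : 0 < mallows321_Z beta n.
Proof.
rewrite /mallows321_Z (bigD1 1%g) /=; last first.
  by apply/avoids321P => i j k ij jk; rewrite !perm1 ltnNge (ltnW jk).
by rewrite ltr_wpDr ?expR_gt0 //; apply: sumr_ge0 => s _; exact: expR_ge0.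
Qed.

Lemma mallows_probE E :
  mallows_prob E = (\sum_(s | avoids321 s && E s) mallows_weight beta s) / mallows321_Z beta n.
Proof.
rewrite mulr_suml big_andbC [RHS]big_mkcondr; apply: eq_bigr => s _.
by rewrite /mallows321_pmf.
Qed.

Lemma mallows_prob_ge0 E : 0 <= mallows_prob E.
Proof.
rewrite mallows_probE divr_ge0 ?(ltW mallows321_Z_gt0) //.
by apply: sumr_ge0 => s _; exact: expR_ge0.
Qed.

Definition low_height M : pred pair := fun q =>
  [exists i in M, (i.+1 <= below q.1 i.+1 + below q.2 i.+1)%N].

(** The quotient of [mallows_upper] by [mallows_lower], in which [balanced_ge]
bounds the probability of [admissible M] from below. *)
Lemma mallows_ratio (E : pred 'S_n) (F : pred pair) M : 0 <= beta ->
  (forall s, avoids321 s -> E s -> F (pair_of s)) ->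
  mallows_prob E * (n.+1%:R^-1 - bern2 p (low_height M)) <= 2 ^+ #|~: M| * bern2 p F.
Proof.
move=> beta0 EF; rewrite mallows_probE.
have p01 := @siteprob01 R beta n.
have Z0 := mallows321_Z_gt0; have c0 := bern_const_gt0 beta n.
have hU := mallows_upper beta EF; have hL := mallows_lower M beta0.
have hq : n.+1%:R^-1 - bern2 p (low_height M) <= bern2 p (admissible M).
  rewrite lerBlDr; apply: le_trans balanced_ge _.
  apply: (@le_trans _ _ (bern2 p (predU (admissible M) (low_height M)))).
    apply: bern2_le => // q; rewrite !inE /= => e.
    rewrite /in_mem /= /admissible e /=; case: (boolP (low_height M q)); rewrite ?orbT //.
    rewrite orbF => /existsPn h; apply/forallP => i; apply/implyP => iM.
    by have := h i; rewrite iM /= -ltnNge.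
  rewrite /bern2 big_mkcond [X in X + _]big_mkcond [X in _ + X]big_mkcond -big_split /=.
  apply: ler_sum => q _; rewrite /in_mem /=.
  have : 0 <= bern p q.1 * bern p q.2 by rewrite mulr_ge0 ?bern_ge0.
  by case: (admissible M q); case: (low_height M q) => /=; lra.
move: hU hL hq; set U := \sum_(s | _) _; set Z := mallows321_Z _ _; set c := bern_const _ _.
set q := bern2 p (admissible _); set q' := n.+1%:R^-1 - _; set b := bern2 p F => hU hL hq.
have U0 : 0 <= U by apply: sumr_ge0 => s _; exact: expR_ge0.
have b0 : 0 <= b by exact: bern2_ge0.
have q0 : 0 <= q by exact: bern2_ge0.
apply: (@le_trans _ _ (U / Z * q)).
  by rewrite ler_wpM2l // divr_ge0 // ltW.
rewrite mulrAC ler_pdivrMr //.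
rewrite -(ler_pM2l c0).
apply: (@le_trans _ _ (U * (2 ^+ #|~: M| * Z))).
  by rewrite mulrCA ler_wpM2l.
apply: (@le_trans _ _ (c * b * (2 ^+ #|~: M| * Z))).
  by rewrite ler_wpM2r // mulr_ge0 ?exprn_ge0 // ltW.
have -> (x y z t : R) : x * y * (z * t) = x * (z * y * t) by ring.
exact: lexx.
Qed.

End ratio.

Section tilt.
Context (R : realType) (n : nat).

(** The ratio of the weights at b and b' decreases with the number of
inversions.  With k its value at m, it is at most k on the event and at least k
off it. *)
Lemma mallows_inv_mono (b b' : R) (m : nat) : (0 < n)%N -> b <= b' ->
  mallows_prob b [pred s : 'S_n | (m < ninv s)%N] <=
  mallows_prob b' [pred s : 'S_n | (m < ninv s)%N].
Proof.
move=> n0 bb'; rewrite !mallows_probE.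
have Z0 := mallows321_Z_gt0 b n; have Z0' := mallows321_Z_gt0 b' n.
rewrite ler_pdivrMr // mulrAC ler_pdivlMr //.
rewrite /mallows321_Z.
rewrite [X in _ * X <= _](bigID [pred s : 'S_n | (m < ninv s)%N]) /=.
rewrite [X in _ <= _ * X](bigID [pred s : 'S_n | (m < ninv s)%N]) /=.
set U := \sum_(s | _) mallows_weight b s.
set V := \sum_(s | _ && ~~ _) mallows_weight b s.
set U' := \sum_(s | _ && _) mallows_weight b' s.
set V' := \sum_(s | _ && ~~ _) mallows_weight b' s.
pose k : R := expR ((b - b') / n%:R * m%:R).
have d0 : (b - b') / n%:R <= 0 by rewrite pmulr_lle0 ?invr_gt0 ?ltr0n // subr_le0.
have tw (s : 'S_n) : mallows_weight b s =
    expR ((b - b') / n%:R * (ninv s)%:R) * mallows_weight b' s.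
  by rewrite /mallows_weight -expRD; congr expR; field; rewrite pnatr_eq0 -lt0n.
have hU : U <= k * U'.
  rewrite /U' mulr_sumr; apply: ler_sum => s /andP[_ ms]; rewrite tw.
  by rewrite ler_wpM2r ?expR_ge0 // ler_expR ler_wnM2l // ler_nat ltnW.
have hV : k * V' <= V.
  rewrite /V' mulr_sumr; apply: ler_sum => s /andP[_ ms]; rewrite tw.
  by rewrite ler_wpM2r ?expR_ge0 // ler_expR ler_wnM2l // ler_nat leqNgt.
have U0 : 0 <= U by apply: sumr_ge0 => s _; exact: expR_ge0.
have U0' : 0 <= U' by apply: sumr_ge0 => s _; exact: expR_ge0.
have V0 : 0 <= V by apply: sumr_ge0 => s _; exact: expR_ge0.
have V0' : 0 <= V' by apply: sumr_ge0 => s _; exact: expR_ge0.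
have h1 := ler_wpM2r V0' hU; have h2 := ler_wpM2r U0' hV.
nra.
Qed.

End tilt.

Local Open Scope classical_set_scope.
Local Open Scope ring_scope.

(** * The density and its primitive *)

Section primitive.
Context (R : realType) (beta : R).
Hypothesis beta0 : 0 < beta.
Implicit Types x y : R.

(** The integral of [rho321 beta] from 0 to x. *)
Definition rhoint x : R :=
  ln ((expR (beta * x) + expR (beta / 2)) / (1 + expR (beta / 2))) / beta.

Local Notation E := (expR (beta / 2)).
Let E_gt1 : 1 < E. Proof. by rewrite -[ltLHS]expR0 ltr_expR divr_gt0. Qed.

(** Through this identity, inequalities between values of [rhoint] become
polynomial inequalities between exponentials. *)
Lemma expR_rhoint x :
  expR (beta * rhoint x) * (1 + E) = expR (beta * x) + E.
Proof.
have E1 := E_gt1; have beta_gt0 := beta0.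
rewrite /rhoint [beta * _]mulrC divfK ?gt_eqF //.
have h := expR_gt0 (beta * x); have h1 : 0 < 1 + E by lra.
by rewrite lnK ?posrE ?divr_gt0 //; [field; rewrite gt_eqF|lra].
Qed.

Lemma rhoint0 : rhoint 0 = 0.
Proof. by rewrite /rhoint mulr0 expR0 divff ?ln1 ?mul0r // gt_eqF // ltr_wpDr ?expR_ge0. Qed.

Lemma rhoint1 : rhoint 1 = 2^-1.
Proof.
have E1 := E_gt1; have beta_gt0 := beta0.
have b0 : beta != 0 by rewrite gt_eqF.
apply: (mulfI b0); apply: (@expR_inj R).
have h : 1 + E != 0 by rewrite gt_eqF //; lra.
apply: (mulIf h); rewrite expR_rhoint mulr1.
have -> : expR beta = E * E by rewrite -expRD; congr expR; field.
by ring.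
Qed.

Lemma is_derive_rhoint x : is_derive x 1 rhoint (rho321 beta x).
Proof.
have E1 := E_gt1; have beta_gt0 := beta0.
have h := expR_gt0 (beta * x).
pose g y : R := (expR (beta * y) + E) / (1 + E).
have g0 : 0 < g x by rewrite divr_gt0 //; lra.
have dg : is_derive x 1 g (beta * expR (beta * x) / (1 + E)).
  rewrite /g; apply: is_derive_eq.
  by rewrite /GRing.scale /=; ring.
have dl := is_derive1_ln g0.
have -> : rhoint = (fun y => ((@ln R) \o g) y * beta^-1) by [].
apply: is_derive_eq.
rewrite /GRing.scale /= /g /rho321.
have -> : beta * (2^-1 - x) = beta / 2 - beta * x by ring.
rewrite expRD expRN; field.
by rewrite !gt_eqF //; lra.
Qed.

Lemma continuous_rhoint : continuous rhoint.
Proof.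
move=> x; apply: differentiable_continuous; apply/derivable1_diffP.
by have [] := is_derive_rhoint x.
Qed.

Lemma rho321_bounds x : 0 < rho321 beta x < 1.
Proof.
have h := expR_gt0 (beta * (2^-1 - x)).
by rewrite /rho321 invr_gt0 invf_lt1; lra.
Qed.

Lemma rho321_le x y : x <= y -> rho321 beta x <= rho321 beta y.
Proof.
move=> xy; rewrite /rho321 lef_pV2 ?posrE ?ltr_wpDr ?expR_ge0 //.
by rewrite lerD2l ler_expR ler_pM2l // lerD2l lerN2.
Qed.

Lemma rhoint_mvt x y : x <= y ->
  exists2 z, x <= z <= y & rhoint y - rhoint x = rho321 beta z * (y - x).
Proof.
move=> xy.
have [z] := @MVT_segment R rhoint (rho321 beta) x y xy (fun t _ => is_derive_rhoint t)
  (continuous_subspaceT continuous_rhoint).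
by rewrite in_itv /= => zxy e; exists z.
Qed.

Lemma rhoint_slope x y : x <= y -> 0 <= rhoint y - rhoint x <= y - x.
Proof.
move=> xy; have [z _ ->] := rhoint_mvt xy; have := rho321_bounds z => zb.
have : 0 <= y - x by lra.
nra.
Qed.

Lemma rhoint_lt x y : x < y -> rhoint x < rhoint y.
Proof.
move=> xy; have [z _ e] := rhoint_mvt (ltW xy).
rewrite -subr_gt0 e mulr_gt0 ?subr_gt0 //.
by case/andP: (rho321_bounds z).
Qed.

Lemma ler_rhoint x y : (rhoint x <= rhoint y) = (x <= y).
Proof. by apply: (le_mono rhoint_lt). Qed.

(** With X = exp(beta x) and E = exp(beta / 2) this reads
(X - 1)(E^2 - X) > 0.  It is what makes the mean height positive. *)
Lemma rhoint_lt_half x : 0 < x < 1 -> rhoint x < x / 2.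
Proof.
have E1 := E_gt1; have beta_gt0 := beta0.
move=> /andP[x0 x1].
have b2 : 0 < 2 * beta by lra.
rewrite -(ltr_pM2l b2) -ltr_expR.
have -> : 2 * beta * rhoint x = beta * rhoint x + beta * rhoint x by ring.
have -> : 2 * beta * (x / 2) = beta * x by field.
have h0 : 0 < (1 + E) ^+ 2 by rewrite exprn_gt0 //; lra.
rewrite -(ltr_pM2r h0) expRD.
have -> (a : R) : a * a * (1 + E) ^+ 2 = (a * (1 + E)) ^+ 2 by ring.
rewrite expR_rhoint; set X := expR (beta * x).
have X1 : 1 < X by rewrite -[ltLHS]expR0 ltr_expR mulr_gt0.
have XE : X < E ^+ 2.
  by rewrite expr2 -expRD ltr_expR -mulrDr ltr_pM2l //; lra.
have : (X - 1) * (E ^+ 2 - X) > 0 by rewrite mulr_gt0 // subr_gt0.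
by lra.
Qed.

Lemma rhoint_le_half x : 0 <= x <= 1 -> rhoint x <= x / 2.
Proof.
move=> /andP[]; rewrite le_eqVlt => /orP[/eqP <- _|x0].
  by rewrite rhoint0 mul0r.
rewrite le_eqVlt => /orP[/eqP ->|x1]; first by rewrite rhoint1 div1r.
by rewrite ltW // rhoint_lt_half // x0.
Qed.

(** With X = exp(beta x), Y = exp(beta y) and E = exp(beta / 2), both sides read
(X + E)(Y + E) <= Y (1 + E)^2.  So f321 is the composite of G = [rhoint beta]
with the inverse of y - G(y). *)
Lemma f321_le x y : 0 <= x <= 1 ->
  (f321 beta x <= y) = (rhoint x + rhoint y <= y).
Proof.
have E1 := E_gt1; have beta_gt0 := beta0.
move=> /andP[x0 x1]; rewrite /f321.
set X := expR (beta * x); set Y := expR (beta * y).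
have X0 : 0 < X by exact: expR_gt0.
have Y0 : 0 < Y by exact: expR_gt0.
have XE : X <= E ^+ 2.
  by rewrite /X expr2 -expRD ler_expR -mulrDr ler_pM2l //; lra.
have EE : expR beta = E ^+ 2.
  by rewrite expr2 -expRD; congr expR; field.
rewrite EE; set D := 1 + E + E ^+ 2 - X; have D0 : 0 < D by rewrite /D; lra.
have q0 : 0 < (X + E) / D by rewrite divr_gt0 //; lra.
have -> : (2^-1 + beta^-1 * ln ((X + E) / D) <= y) = ((X + E) * E <= Y * D).
  rewrite -(ler_pM2l beta0) -[LHS]ler_expR mulrDr expRD mulrA divff ?gt_eqF // mul1r.
  by rewrite lnK ?posrE // -/Y mulrA ler_pdivrMr // [E * _]mulrC.
have -> : (rhoint x + rhoint y <= y) = ((X + E) * (Y + E) <= Y * (1 + E) ^+ 2).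
  have h0 : 0 < (1 + E) ^+ 2 by rewrite exprn_gt0 //; lra.
  rewrite -(ler_pM2l beta0) -[LHS]ler_expR mulrDr expRD -[LHS](ler_pM2r h0).
  have -> (a b : R) : a * b * (1 + E) ^+ 2 = (a * (1 + E)) * (b * (1 + E)) by ring.
  by rewrite (expR_rhoint x) (expR_rhoint y).
by rewrite /D; apply/idP/idP => h; lra.
Qed.

(** As rho increases, both the i-th term and the i-th increment of n G lie between
the values of rho at the ends of the i-th cell, and these gaps telescope. *)
Lemma rhoint_riemann (n k : nat) : (0 < n)%N ->
  `|\sum_(i < k) rho321 beta ((i%:R + 2^-1) / n%:R) - n%:R * rhoint (k%:R / n%:R)| <= 1.
Proof.
move=> n0; have nR : 0 < n%:R :> R by rewrite ltr0n.
suff : `|\sum_(i < k) rho321 beta ((i%:R + 2^-1) / n%:R) - n%:R * rhoint (k%:R / n%:R)|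
    <= rho321 beta (k%:R / n%:R) - rho321 beta 0.
  move/le_trans; apply; have := rho321_bounds (k%:R / n%:R).
  by have := rho321_bounds 0; lra.
elim: k => [|k IH]; first by rewrite big_ord0 mul0r rhoint0 mulr0 !subrr normr0.
rewrite big_ord_recr /=.
have st : k%:R / n%:R <= k.+1%:R / n%:R :> R by rewrite ler_pM2r ?invr_gt0 // ler_nat.
have [z /andP[z1 z2] e] := rhoint_mvt st.
have e' : n%:R * rhoint (k.+1%:R / n%:R) = n%:R * rhoint (k%:R / n%:R) + rho321 beta z.
  apply/eqP; rewrite addrC -subr_eq -mulrBr e -mulrBl -natrB // subSnn mulrCA mul1r divff ?mulr1 //.
  by rewrite gt_eqF.
rewrite e'.
have m1 : k%:R / n%:R <= (k%:R + 2^-1) / n%:R :> R.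
  by rewrite ler_pM2r ?invr_gt0 // lerDl invr_ge0.
have m2 : (k%:R + 2^-1) / n%:R <= k.+1%:R / n%:R :> R.
  by rewrite ler_pM2r ?invr_gt0 // -[leRHS]natr1 lerD2l; lra.
have := rho321_le m1; have := rho321_le m2; have := rho321_le z1; have := rho321_le z2.
move: IH; rewrite !ler_norml; lra.
Qed.

End primitive.

(** * Transfer of exponentially small probabilities *)

Section expsmall.
Context (R : realType).

Definition exp_small (u : nat -> R) :=
  exists2 c, 0 < c & \forall n \near \oo, u n <= expR (- c * n%:R).

Lemma expR_cube (x : R) : expR (3 * x) = expR x ^+ 3.
Proof. by rewrite -expRM_natl mulrC. Qed.

(** exp(c n) = exp(c n / 3)^3 >= (c n / 3)^3. *)
Lemma square_le_exp (a c : R) : 0 < c ->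
  \forall n \near \oo, a * n%:R ^+ 2 <= expR (c * n%:R).
Proof.
move=> c0; near=> n.
have nR : 0 <= n%:R :> R by [].
have big : 27 * `|a| / c ^+ 3 <= n%:R by near: n; exact: nbhs_infty_ger.
have c3 : 0 < c ^+ 3 by rewrite exprn_gt0.
rewrite ler_pdivrMr // in big.
pose x := c * n%:R / 3.
have -> : c * n%:R = 3 * x by rewrite /x; field.
rewrite expR_cube.
have x0 : 0 <= x by rewrite /x divr_ge0 // mulr_ge0 // ltW.
have h : x ^+ 3 <= expR x ^+ 3.
  by apply: lerXn2r; rewrite ?nnegrE ?expR_ge0 //; have := expR_ge1Dx x; lra.
apply: le_trans h.
have -> : x ^+ 3 = (n%:R * c ^+ 3) * n%:R ^+ 2 / 27 by rewrite /x; field.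
rewrite ler_pdivlMr //.
have a1 : a <= `|a| by exact: ler_norm.
have s0 : 0 <= n%:R ^+ 2 :> R by exact: sqr_ge0.
apply: (@le_trans _ _ ((27 * `|a|) * n%:R ^+ 2)).
  by have := ler_wpM2r s0 a1; lra.
by rewrite ler_wpM2r.
Unshelve. all: by end_near. Qed.

End expsmall.

Section concentration.
Context (R : realType) (beta : R).
Hypothesis beta0 : 0 < beta.
Local Notation G := (rhoint beta).

(** A positive continuous function on a compact interval has a positive
minimum. *)
Lemma height_gap (d : R) : 0 < d < 2^-1 ->
  exists2 c, 0 < c <= 1 & forall x, d <= x <= 1 - d -> c <= x - 2 * G x.
Proof.
move=> /andP[d0 d1].
have dd : d <= 1 - d by lra.
pose g x := x - 2 * G x.
have cg : continuous g.
  move=> x; apply: cvgB; first exact: cvg_id.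
  by apply: cvgM; [exact: cvg_cst|exact: continuous_rhoint].
have [c + cmin] := EVT_min dd (continuous_subspaceT cg).
rewrite in_itv /= => /andP[c1 c2]; exists (g c).
  have c01 : 0 < c < 1 by lra.
  have := rhoint_lt_half beta0 c01; have := rhoint_lt beta0 (_ : 0 < c).
  by rewrite rhoint0 // => /(_ ltac:(lra)); rewrite /g; lra.
by move=> x xd; apply: cmin; rewrite in_itv.
Qed.

Definition site_mean n k : R := \sum_(i < k) rho321 beta ((i%:R + 2^-1) / n%:R).

Lemma dev_below n k (X : {set 'I_n}) : (k <= n)%N ->
  dev (@siteprob R beta n) (fun i => (i < k)%N%:R) X = (below X k)%:R - site_mean n k.
Proof.
move=> kn; rewrite /dev /below -sum1_card natr_sum.
under [X in X = _]eq_bigr do rewrite mulrBr; rewrite sumrB; congr (_ - _).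
  rewrite [RHS]big_mkcond; apply: eq_bigr => i _.
  by rewrite !inE; case: (i \in X); case: (i < k)%N; rewrite ?mulr1 ?mulr0.
rewrite /site_mean (big_ord_widen n (fun i => rho321 beta ((i%:R + 2^-1) / n%:R)) kn).
rewrite [RHS]big_mkcond; apply: eq_bigr => i _.
by case: ifP; rewrite ?mul1r ?mul0r.
Qed.

Lemma indic_le1 n k (i : 'I_n) : `|(i < k)%N%:R| <= 1 :> R.
Proof. by case: (i < k)%N; rewrite ?normr1 ?normr0. Qed.

(** At t = [i.+1] the mean height is n (x - 2 G(x)) with x = t / n, up to the
bounded Riemann error.  By [height_gap] it is of order n, so a height at most 0
is a large deviation; sum over i. *)
Lemma low_height_small (d : R) : 0 < d < 2^-1 ->
  exists2 c, 0 < c & \forall n \near \oo, forall M : {set 'I_n},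
    (forall i, i \in M -> d <= i.+1%:R / n%:R <= 1 - d) ->
    bern2 (@siteprob R beta n) (low_height M) <= n%:R * expR (- c * n%:R).
Proof.
move=> /height_gap[g /andP[g0 g1] gP]; exists ((g / 2) ^+ 2 / 16).
  by rewrite divr_gt0 // exprn_gt0 // divr_gt0.
near=> n => M MP.
have n0 : (0 < n)%N by near: n; exact: nbhs_infty_gt.
have nR : 0 < n%:R :> R by rewrite ltr0n.
have big : 4 / g <= n%:R by near: n; exact: nbhs_infty_ger.
rewrite ler_pdivrMr // in big.
have p01 := @siteprob01 R beta n.
apply: le_trans (bern2_union p01 (mem M)
  (fun i q => (i.+1 <= below q.1 i.+1 + below q.2 i.+1)%N)) _.
apply: (@le_trans _ _ (\sum_(i in M) expR (- ((g / 2) ^+ 2 / 16) * n%:R))); last first.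
  rewrite sumr_const -[leLHS]mulr_natl ler_wpM2r ?expR_ge0 // ler_nat.
  by rewrite -[leqRHS]card_ord max_card.
apply: ler_sum => i iM.
have c1 := @indic_le1 n i.+1; have g2 : 0 <= g / 2 <= 1 by lra.
apply: le_trans (bern2_chernoff p01 c1 c1 g2).
apply: bern2_le => // q; rewrite !inE /= => h.
rewrite !dev_below ?ltn_ord //.
have := rhoint_riemann beta0 i.+1 n0; rewrite -/(site_mean n i.+1) ler_norml => /andP[_ e].
have := gP _ (MP i iM); rewrite -(ler_pM2r nR) mulrBl -mulrA mulVf ?gt_eqF // mulr1.
have : (i.+1%:R : R) <= (below q.1 i.+1)%:R + (below q.2 i.+1)%:R by rewrite -natrD ler_nat.
lra.
Unshelve. all: by end_near. Qed.

(** In [mallows_ratio] take for M the positions at distance more than d n from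
both ends.  There the height is positive up to an exponentially small
probability, negligible against 1 / (n + 1), while the loss [2 ^ #|~: M|] is at
most exp(2 d n + 2), which d <= c / 16 keeps below exp(c n / 8 + 2). *)
Lemma mallows_exp_small (c : R) (E : forall n, pred 'S_n)
    (F : forall n, pred ({set 'I_n} * {set 'I_n})) : 0 < c ->
  (\forall n \near \oo, forall s : 'S_n, avoids321 s -> E n s -> F n (pair_of s)) ->
  (\forall n \near \oo,
     bern2 (@siteprob R beta n) (F n) <= 2 * expR (- c * n%:R)) ->
  exp_small (fun n => mallows_prob beta (E n)).
Proof.
move=> c0 EF Fc; exists (c / 2); first by rewrite divr_gt0.
pose d := Num.min (c / 16) (1 / 4).
have d0 : 0 < d < 2^-1 by rewrite lt_min gt_min; lra.
have dc : d <= c / 16 by rewrite ge_min lexx.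
have [c1 c10 low] := low_height_small d0.
have poly1 := square_le_exp 4 c10.
have c80 : 0 < c / 8 by rewrite divr_gt0.
have poly2 := square_le_exp (8 * expR 2) c80.
near=> n.
have n0 : (0 < n)%N by near: n; exact: nbhs_infty_gt.
have n1 : 1 <= n%:R :> R by rewrite ler1n.
have nR : 0 < n%:R :> R by rewrite ltr0n.
pose k0 := (Num.truncn (d * n%:R)).+1.
have dn0 : 0 <= d * n%:R by rewrite mulr_ge0 //; lra.
have /andP[k1 k2] := truncn_itv dn0; rewrite -/k0 in k2.
have k1' : k0%:R <= d * n%:R + 1 by rewrite /k0 -natr1; lra.
pose M := [set i : 'I_n | (k0 <= i)%N && (i < n - k0)%N]%SET.
have MP i : i \in M -> d <= i.+1%:R / n%:R <= 1 - d.
  rewrite inE => /andP[i1 i2]; rewrite ler_pdivlMr // ler_pdivrMr //.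
  have : k0%:R <= i%:R :> R by rewrite ler_nat.
  have : i.+1%:R + k0%:R <= n%:R :> R by rewrite -natrD ler_nat addSn addnC -ltn_subRL.
  by rewrite -natr1; lra.
have cM : (#|~: M| <= 2 * k0)%N.
  have -> : ~: M = [set i : 'I_n | (i < k0)%N]%SET :|: [set i : 'I_n | (n - k0 <= i)%N]%SET.
    by apply/setP => i; rewrite !inE negb_and -ltnNge -leqNgt.
  apply: leq_trans (leq_card_setU _ _) _; rewrite mul2n -addnn leq_add //.
    have [kn|/ltnW kn] := leqP k0 n; first by rewrite card_ord_lt.
    by rewrite (leq_trans _ kn) // -[leqRHS]card_ord max_card.
  have := cardsC [set i : 'I_n | (i < n - k0)%N]%SET.
  rewrite card_ord_lt ?leq_subr // card_ord => e.
  rewrite (_ : [set i : 'I_n | (n - k0 <= i)%N]%SET = ~: [set i : 'I_n | (i < n - k0)%N]%SET).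
    by rewrite -(leq_add2l (n - k0)%N) e addnC -leq_subLR.
  by apply/setP => i; rewrite !inE leqNgt.
have low' : bern2 (@siteprob R beta n) (low_height M) <= n%:R * expR (- c1 * n%:R).
  by move: M MP {cM}; near: n.
have Fb : bern2 (@siteprob R beta n) (F n) <= 2 * expR (- c * n%:R) by near: n.
have EF' : forall s : 'S_n, avoids321 s -> E n s -> F n (pair_of s) by near: n.
have p1 : 4 * n%:R ^+ 2 <= expR (c1 * n%:R) by near: n.
have p2 : 8 * expR 2 * n%:R ^+ 2 <= expR (c / 8 * n%:R) by near: n.
have := mallows_ratio n0 M (ltW beta0) EF'.
set u := mallows_prob _ _; set q := bern2 _ (low_height M) => ratio.
have u0 : 0 <= u by exact: mallows_prob_ge0.
have nn : n.+1%:R <= 2 * n%:R :> R by rewrite -natr1; lra.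
have nn0 : 0 < n.+1%:R :> R by rewrite ltr0n.
have q1 : q <= (2 * n.+1%:R)^-1.
  apply: le_trans low' _.
  rewrite mulNr expRN ler_pdivrMr ?expR_gt0 // mulrC ler_pdivlMr ?mulr_gt0 //.
  apply: le_trans p1; rewrite expr2; nra.
have u1 : u * (2 * n.+1%:R)^-1 <= 2 ^+ #|~: M| * (2 * expR (- c * n%:R)).
  apply: (@le_trans _ _ (u * (n.+1%:R^-1 - q))).
    rewrite ler_wpM2l // lerBrDl; apply: le_trans (lerD q1 (lexx _)) _.
    by rewrite le_eqVlt; apply/orP; left; apply/eqP; field.
  by apply: le_trans ratio _; rewrite ler_wpM2l // exprn_ge0.
have e2 : 2 ^+ #|~: M| <= expR (2 + c / 8 * n%:R).
  apply: (@le_trans _ _ (expR 1 ^+ #|~: M|)).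
    by apply: lerXn2r; rewrite ?nnegrE ?expR_ge0 //; have := expR_ge1Dx (1 : R); lra.
  rewrite -expRM_natl mulr1 ler_expR.
  have : #|~: M|%:R <= 2 * k0%:R :> R by rewrite -natrM ler_nat.
  have := ler_wpM2r (ltW nR) dc; lra.
rewrite ler_pdivrMr ?mulr_gt0 // in u1.
have t0 : 0 <= 2 * expR (- c * n%:R) by rewrite mulr_ge0 ?expR_ge0.
have t1 : 0 <= 2 * n.+1%:R :> R by rewrite mulr_ge0.
apply: le_trans u1 _.
apply: le_trans (ler_wpM2r t1 (ler_wpM2r t0 e2)) _.
have -> : expR (- (c / 2) * n%:R) = expR (c / 2 * n%:R) * expR (- c * n%:R).
  by rewrite -expRD; congr expR; field.
rewrite expRD.
set X := expR (c / 8 * n%:R) in p2 *.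
have X0 : 0 <= X by exact: expR_ge0.
have -> : expR (c / 2 * n%:R) = X ^+ 4.
  by rewrite /X -expRM_natl; congr expR; field.
have e0 : 0 <= expR 2 :> R by exact: expR_ge0.
have y0 : 0 <= expR (- c * n%:R) by exact: expR_ge0.
have X1 : 1 <= X by rewrite -[leLHS]expR0 ler_expR mulr_ge0 // divr_ge0 // ltW.
have h1 : expR 2 * (4 * n.+1%:R) <= X.
  apply: le_trans p2; rewrite expr2.
  have : n.+1%:R * 4 <= 8 * (n%:R * n%:R) :> R by nra.
  by move/(ler_wpM2l e0); lra.
have h2 : X * X <= X ^+ 4.
  have -> : X ^+ 4 = X * X * (X * X) by ring.
  by rewrite ler_peMr ?mulr_ge0 //; nra.
have h3 : expR 2 * (4 * n.+1%:R) * X <= X ^+ 4.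
  by apply: le_trans h2; rewrite ler_wpM2r.
have := ler_wpM2r y0 h3; lra.
Unshelve. all: by end_near. Qed.

End concentration.

(** * Concentration of the number of points in a quadrant *)

Section hits_cvg.
Context (R : realType).
Implicit Types x y e : R.

Definition hits_at n (s : 'S_n) x y : R :=
  (hits s (Num.truncn (n%:R * x)) (Num.truncn (n%:R * y)))%:R / n%:R.

Lemma truncn_scale n x : (0 < n)%N -> 0 <= x <= 1 ->
  [/\ (Num.truncn (n%:R * x) <= n)%N,
      (Num.truncn (n%:R * x))%:R / n%:R <= x &
      x <= (Num.truncn (n%:R * x))%:R / n%:R + n%:R^-1].
Proof.
move=> n0 /andP[x0 x1]; have nR : 0 < n%:R :> R by rewrite ltr0n.
have nx0 : 0 <= n%:R * x by rewrite mulr_ge0.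
have /andP[t1 t2] := truncn_itv nx0.
split.
- rewrite -(ler_nat R); apply: le_trans t1 _.
  by rewrite -[leRHS]mulr1 ler_pM2l.
- by rewrite ler_pdivrMr // [x * _]mulrC.
- rewrite -[X in _ + X]mul1r -mulrDl ler_pdivlMr // natr1 [x * _]mulrC; exact: ltW.
Qed.

(** The minimum is 1-Lipschitz for the sup norm. *)
Lemma min_dist (a b c d h : R) : `|a - c| <= h -> `|b - d| <= h ->
  `|Num.min a b - Num.min c d| <= h.
Proof.
rewrite !ler_norml => /andP[a1 a2] /andP[b1 b2].
by case: (leP a b) => ab; case: (leP c d) => cd; lra.
Qed.

Section positive.
Variable beta : R.
Hypothesis beta0 : 0 < beta.
Local Notation G := (rhoint beta).

Definition cdf321 x y : R := Num.min (Num.min x y) (G x + G y).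

(** Divide [hits_exc] by n and compare the three entries of the minimum.
Replacing k / n by x costs 1 / n, replacing the centring terms by n G costs 2 by
[rhoint_riemann], and G is 1-Lipschitz. *)
Lemma hits_cdf321 n (s : 'S_n) x y h : (0 < n)%N -> avoids321 s ->
  0 <= x <= 1 -> 0 <= y <= 1 ->
  let k := Num.truncn (n%:R * x) in let l := Num.truncn (n%:R * y) in
  `|dev (@siteprob R beta n) (fun i => (i < k)%N%:R) (~: exc s) +
    dev (@siteprob R beta n) (fun i => (i < l)%N%:R) (s @: exc s)%SET| <= h * n%:R ->
  `|hits_at s x y - cdf321 x y| <= h + 4 / n%:R.
Proof.
move=> n0 av x01 y01 k l; have nR : 0 < n%:R :> R by rewrite ltr0n.
have [kn k1 k2] := truncn_scale n0 x01; rewrite -/k in kn k1 k2.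
have [ln l1 l2] := truncn_scale n0 y01; rewrite -/l in ln l1 l2.
rewrite !dev_below // => hd.
rewrite /hits_at -/k -/l hits_exc // /cdf321.
have -> (a b c : nat) : ((minn (minn a b) c)%:R : R) / n%:R =
    Num.min (Num.min (a%:R / n%:R) (b%:R / n%:R)) (c%:R / n%:R).
  by rewrite !natr_min !minr_pMl ?invr_ge0.
have i0 : 0 < n%:R^-1 :> R by rewrite invr_gt0.
have h0 : 0 <= h.
  by have := le_trans (normr_ge0 _) hd; rewrite pmulr_lge0.
apply: min_dist.
  by apply: min_dist; rewrite ler_norml; apply/andP; split; lra.
have gx := rhoint_slope beta0 k1; have gy := rhoint_slope beta0 l1.
have := rhoint_riemann beta0 k n0; have := rhoint_riemann beta0 l n0.
rewrite -/(site_mean beta n k) -/(site_mean beta n l).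
move: hd; rewrite natrD.
set b1 : R := (below _ k)%:R; set b2 : R := (below _ l)%:R.
set m1 := site_mean _ _ k; set m2 := site_mean _ _ l.
set g1 := G (k%:R / n%:R); set g2 := G (l%:R / n%:R).
move=> hd r2 r1.
have e : (b1 + b2) / n%:R - (G x + G y) =
   ((b1 - m1) + (b2 - m2) + (m1 - n%:R * g1) + (m2 - n%:R * g2)) / n%:R
    + (g1 - G x) + (g2 - G y).
  by field; rewrite gt_eqF.
rewrite e.
have q : `|((b1 - m1) + (b2 - m2) + (m1 - n%:R * g1) + (m2 - n%:R * g2)) / n%:R|
    <= h + 2 / n%:R.
  rewrite normrM (ger0_norm (ltW i0)) ler_pdivrMr // mulrDl divfK ?gt_eqF //.
  move: hd r1 r2; rewrite !ler_norml => *; apply/andP; split; lra.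
move: q gx gy; rewrite -/g1 -/g2 !ler_norml => q gx gy; apply/andP; split; lra.
Qed.

(** [bern2_chernoff] for both signs, through [hits_cdf321]. *)
Lemma hits_concentration x y e : 0 <= x <= 1 -> 0 <= y <= 1 -> 0 < e <= 1 ->
  exp_small (fun n => mallows_prob beta
    [pred s : 'S_n | e < `|hits_at s x y - cdf321 x y| ]).
Proof.
move=> x01 y01 /andP[e0 e1].
pose k n := Num.truncn (n%:R * x); pose l n := Num.truncn (n%:R * y).
pose r := e / 2; have r01 : 0 <= r <= 1 by rewrite /r; lra.
pose D n (q : {set 'I_n} * {set 'I_n}) : R :=
  dev (@siteprob R beta n) (fun i => (i < k n)%N%:R) q.1 +
  dev (@siteprob R beta n) (fun i => (i < l n)%N%:R) q.2.
apply: (@mallows_exp_small R beta beta0 (r ^+ 2 / 16) _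
   (fun n => [pred q | r * n%:R <= `|D n q|])).
- by rewrite divr_gt0 // exprn_gt0 // divr_gt0.
- near=> n => s av /=.
  have n0 : (0 < n)%N by near: n; exact: nbhs_infty_gt.
  have nR : 0 < n%:R :> R by rewrite ltr0n.
  have big : 8 / e <= n%:R by near: n; exact: nbhs_infty_ger.
  apply: contraTT; rewrite -ltNge -leNgt => /ltW h.
  apply: le_trans (hits_cdf321 n0 av x01 y01 h) _.
  rewrite -lerBrDl ler_pdivrMr //; rewrite ler_pdivrMr // in big.
  by rewrite /r; lra.
- near=> n.
  have n0 : (0 < n)%N by near: n; exact: nbhs_infty_gt.
  have p01 := @siteprob01 R beta n.
  have i1 m : forall i : 'I_n, `|- ((i < m)%N%:R : R)| <= 1.
    by move=> i; rewrite normrN; exact: indic_le1.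
  have devN c X : dev (@siteprob R beta n) (fun i => - c i) X = - dev (@siteprob R beta n) c X.
    by rewrite /dev -sumrN; apply: eq_bigr => i _; rewrite mulNr.
  have h1 := bern2_chernoff p01 (@indic_le1 R n (k n)) (@indic_le1 R n (l n)) r01.
  have h2 := bern2_chernoff p01 (i1 (k n)) (i1 (l n)) r01.
  apply: (@le_trans _ _
    (bern2 (@siteprob R beta n) [pred q | r * n%:R <= D n q] +
     bern2 (@siteprob R beta n) [pred q | r * n%:R <= - D n q])).
    have := bern2_union p01 predT (fun b (q : {set 'I_n} * {set 'I_n}) =>
       if b then r * n%:R <= D n q else r * n%:R <= - D n q).
    rewrite big_bool /=; apply: le_trans; apply: bern2_le => // q; rewrite !inE /= ler_normr.
    by case/orP => h; apply/existsP; [exists true|exists false].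
  rewrite mulrDl mul1r; apply: lerD; first exact: h1.
  apply: le_trans h2; apply: bern2_le => // q; rewrite !inE /= !devN /D opprD.
  by [].
Unshelve. all: by end_near. Qed.

End positive.

Section nonpositive.
Variable beta : R.
Hypothesis beta0 : beta <= 0.

(** exp(t) >= 1 + t at t = b (1/2 - x) >= - b / 2. *)
Lemma rho321_half_gap (b x : R) : 0 < b <= 1 -> 0 <= x <= 1 -> 2 * rho321 b x - 1 <= b.
Proof.
move=> /andP[b0 b1] /andP[x0 x1]; rewrite /rho321.
have : 1 + b * (2^-1 - x) <= expR (b * (2^-1 - x)) by exact: expR_ge1Dx.
set t := expR _ => h.
have t0 : 1 - b / 2 <= t by nra.
have h0 : 0 < 1 + t by lra.
rewrite lerBlDr ler_pdivrMr //; nra.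
Qed.

(** By [ninv_exc] the quotient inv / n is a linear statistic of the pair with
coefficients i / n in [0, 1].  Its mean is at most b n by [rho321_half_gap], so
exceeding e n = 2 b n is a deviation by b n. *)
Lemma inv_concentration (b e : R) : 0 < e <= 1 -> b = e / 2 ->
  exp_small (fun n => mallows_prob b
    [pred s : 'S_n | (Num.truncn (e * n%:R ^+ 2) < ninv s)%N]).
Proof.
move=> /andP[e0 e1] be.
have b0 : 0 < b by rewrite be; lra.
have b01 : 0 < b <= 1 by rewrite be; lra.
pose c n (i : 'I_n) : R := i%:R / n%:R.
pose D n (q : {set 'I_n} * {set 'I_n}) : R :=
  dev (@siteprob R b n) (@c n) q.1 + dev (@siteprob R b n) (@c n) q.2.
have c01 n (i : 'I_n) : 0 <= c n i <= 1.
  have n0 : 0 < n%:R :> R by rewrite ltr0n (leq_ltn_trans _ (ltn_ord i)).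
  by rewrite /c divr_ge0 // ler_pdivrMr // mul1r ler_nat ltnW.
have be01 : 0 <= b <= 1 by lra.
apply: (@mallows_exp_small R b b0 (b ^+ 2 / 16) _ (fun n => [pred q | b * n%:R <= D n q])).
- by rewrite divr_gt0 // exprn_gt0.
- near=> n => s av /= hm.
  have n0 : (0 < n)%N by near: n; exact: nbhs_infty_gt.
  have nR : 0 < n%:R :> R by rewrite ltr0n.
  rewrite truncn_lt_nat ?mulr_ge0 ?(ltW e0) // in hm.
  have key : (ninv s)%:R = n%:R * \sum_(i < n)
      c n i * ((i \in ~: exc s)%:R + (i \in (s @: exc s)%SET)%:R - 1).
    rewrite mulr_sumr.
    have := congr1 (fun k : nat => k%:R : R) (ninv_exc av).
    rewrite natrD !natr_sum => /eqP; rewrite eq_sym -subr_eq => /eqP <-.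
    have -> : \sum_(i in exc s) (s i)%:R = \sum_(i in (s @: exc s)%SET) i%:R :> R.
      by rewrite big_imset //= => i j _ _; exact: perm_inj.
    rewrite [X in X - _]big_mkcond [X in _ - X]big_mkcond -sumrB; apply: eq_bigr => i _.
    rewrite /c mulrA mulrCA divff ?gt_eqF // mulr1 !inE.
    by case: (i \in (s @: exc s)%SET); case: (i < s i)%N => /=; ring.
  have e2 : \sum_(i < n) c n i * ((i \in ~: exc s)%:R + (i \in (s @: exc s)%SET)%:R - 1)
      <= D n (pair_of s) + b * n%:R.
    have -> : b * n%:R = \sum_(i < n) b by rewrite sumr_const card_ord mulr_natr.
    rewrite /D /dev -!big_split /=; apply: ler_sum => i _.
    have x01 : 0 <= ((i%:R + 2^-1) / n%:R : R) <= 1.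
      apply/andP; split; first by rewrite divr_ge0 ?addr_ge0 ?invr_ge0.
      rewrite ler_pdivrMr // mul1r.
      have : i.+1%:R <= n%:R :> R by rewrite ler_nat.
      by rewrite -natr1; lra.
    have := rho321_half_gap b01 x01; rewrite -/(siteprob b i) => h.
    by have /andP[q0 q1] := c01 n i; nra.
  have : e * n%:R ^+ 2 < n%:R * (D n (pair_of s) + b * n%:R).
    by apply: lt_le_trans hm _; rewrite key ler_pM2l.
  by rewrite expr2 mulrCA ltr_pM2l //; rewrite be; lra.
- near=> n.
  have c1 (i : 'I_n) : `|c n i| <= 1 by have /andP[q0 q1] := c01 n i; rewrite ger0_norm.
  apply: le_trans (bern2_chernoff (@siteprob01 R b n) c1 c1 be01) _.
  have := expR_ge0 (- (b ^+ 2 / 16) * n%:R); lra.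
Unshelve. all: by end_near. Qed.

(** With N points in the rectangle, a deviation of N / n from min(x, y) by more
than e makes k - N and l - N at least e n / 2 for large n, hence gives at least e^2 n^2 / 4
inversions by [ninv_hits].  This is unlikely for a small positive parameter, and
more so for beta by [mallows_inv_mono]. *)
Lemma hits_concentration_diag x y e : 0 <= x <= 1 -> 0 <= y <= 1 -> 0 < e <= 1 ->
  exp_small (fun n => mallows_prob beta
    [pred s : 'S_n | e < `|hits_at s x y - Num.min x y| ]).
Proof.
move=> x01 y01 /andP[e0 e1].
pose a := e ^+ 2 / 8.
have a01 : 0 < a <= 1.
  by rewrite /a divr_gt0 ?exprn_gt0 //=; nra.
have [c c0 small] := inv_concentration a01 erefl.
exists c => //; near=> n.
have n0 : (0 < n)%N by near: n; exact: nbhs_infty_gt.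
have nR : 0 < n%:R :> R by rewrite ltr0n.
have big : 2 / e <= n%:R by near: n; exact: nbhs_infty_ger.
have : mallows_prob (a / 2) [pred s : 'S_n | (Num.truncn (a * n%:R ^+ 2) < ninv s)%N]
    <= expR (- c * n%:R).
  by near: n.
apply: le_trans.
have ba : beta <= a / 2 by apply: le_trans beta0 _; lra.
apply: le_trans (mallows_inv_mono _ n0 ba).
have Z0 := mallows321_Z_gt0 beta n.
rewrite !mallows_probE ler_pM2r ?invr_gt0 //.
rewrite [leRHS](bigID [pred s : 'S_n | e < `|hits_at s x y - Num.min x y| ]) /=.
rewrite -[leLHS]addr0; apply: lerD; last by apply: sumr_ge0 => s _; exact: expR_ge0.
rewrite le_eqVlt; apply/orP; left; apply/eqP; apply: eq_bigl => s.
case: (avoids321 s) => //=; apply/idP/idP => [h|/andP[] //].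
rewrite h andbT truncn_lt_nat; last by rewrite mulr_ge0 // ?sqr_ge0 //; lra.
have [kn k1 k2] := truncn_scale n0 x01; have [ln l1 l2] := truncn_scale n0 y01.
move: h; rewrite /hits_at.
set k := Num.truncn _ in kn k1 k2 *; set l := Num.truncn _ in ln l1 l2 *.
have := hits_le s kn ln; rewrite leq_min => /andP[hk hl].
have := ninv_hits s kn ln.
rewrite -(ler_nat R) natrM !natrB // => hinv h.
apply: lt_le_trans hinv.
have i0 : 0 < n%:R^-1 :> R by rewrite invr_gt0.
have ie : n%:R^-1 <= e / 2.
  by rewrite -[leLHS]mul1r ler_pdivrMr //; rewrite ler_pdivrMr // in big; lra.
have hk' : (hits s k l)%:R <= k%:R :> R by rewrite ler_nat.
have hl' : (hits s k l)%:R <= l%:R :> R by rewrite ler_nat.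
have hkn : (hits s k l)%:R / n%:R <= k%:R / n%:R :> R by rewrite ler_pM2r.
have hln : (hits s k l)%:R / n%:R <= l%:R / n%:R :> R by rewrite ler_pM2r.
have mx : Num.min x y <= x by rewrite ge_min lexx.
have my : Num.min x y <= y by rewrite ge_min lexx orbT.
have hm : e < Num.min x y - (hits s k l)%:R / n%:R.
  have hle : (hits s k l)%:R / n%:R <= Num.min x y.
    by rewrite le_min; apply/andP; split; lra.
  by move: h; rewrite distrC ger0_norm ?subr_ge0.
have d1 : e / 2 * n%:R <= k%:R - (hits s k l)%:R.
  by rewrite -ler_pdivlMr // mulrBl; lra.
have d2 : e / 2 * n%:R <= l%:R - (hits s k l)%:R.
  by rewrite -ler_pdivlMr // mulrBl; lra.
have d0 : 0 < e / 2 * n%:R by rewrite mulr_gt0 // divr_gt0.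
apply: lt_le_trans (ler_pM (ltW d0) (ltW d0) d1 d2).
rewrite /a; have : 0 < (e * n%:R) ^+ 2 by rewrite exprn_gt0 // mulr_gt0.
by lra.
Unshelve. all: by end_near. Qed.

End nonpositive.

End hits_cvg.

(** * Weak convergence from distribution functions *)

Section finite_partition.
Context d (T : measurableType d) (R : realType).
Variable mu : {measure set T -> \bar R}.
Hypothesis mufin : (mu setT < +oo)%E.

Lemma fin_measure A : measurable A -> mu A \is a fin_num.
Proof.
move=> mA; rewrite ge0_fin_numE //; apply: le_lt_trans mufin.
by apply: le_measure; rewrite ?inE.
Qed.

Lemma fine_measureD A B : measurable A -> measurable B -> B `<=` A ->
  fine (mu (A `\` B)) = fine (mu A) - fine (mu B).
Proof.
move=> mA mB BA; rewrite measureD // ?ltey_eq ?fin_measure //.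
by rewrite (setIidr BA) fineB ?fin_measure.
Qed.

Variables (I : finType) (D : I -> set T) (S : set T) (f : T -> R) (c : I -> R) (e : R).
Hypotheses (mD : forall i, measurable (D i)) (tD : trivIset setT D).
Hypotheses (SD : S = \bigcup_i D i) (mf : measurable_fun S f).
Hypothesis fc : forall i x, D i x -> `|f x - c i| <= e.

Let SE : S = \big[setU/set0]_(i <- enum I) D i.
Proof.
rewrite SD -bigcup_seq; apply: eq_bigcupl; split => i // _.
by rewrite /= mem_enum.
Qed.

(** On each piece the integral of f is that of its approximating constant up to
e times the mass.  Finiteness of the integral is part of the conclusion, since
the integral takes extended real values. *)
Lemma integral_partition :
  exists2 v, (\int[mu]_(x in S) (f x)%:E = v%:E)%E &
  `|v - \sum_i c i * fine (mu (D i))| <= e * \sum_i fine (mu (D i)).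
Proof.
have DS i : D i `<=` S by rewrite SD; exact: bigcup_sup.
have mS : measurable S by rewrite SE; apply: bigsetU_measurable.
have bnd i : exists2 w, (\int[mu]_(x in D i) (f x)%:E = w%:E)%E &
    `|w - c i * fine (mu (D i))| <= e * fine (mu (D i)).
  have mfi : measurable_fun (D i) f by apply: measurable_funS mf.
  have fi : mu.-integrable (D i) (EFin \o f).
    apply: measurable_bounded_integrable => //.
      by rewrite ltey_eq fin_measure.
    exists (`|c i| + e); split; first exact: num_real.
    move=> M hM x Dx /=; apply: le_trans (ltW hM).
    have := fc Dx; rewrite -lerBlDl; apply: le_trans.
    by rewrite lerBlDl -[X in `|X| <= _](subrK (c i)) addrC ler_normD.
  have fin : (\int[mu]_(x in D i) (f x)%:E)%E \is a fin_num by exact: integrable_fin_num.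
  exists (fine (\int[mu]_(x in D i) (f x)%:E)%E); first by rewrite fineK.
  have ci (r : R) : mu.-integrable (D i) (EFin \o cst r).
    apply: measurable_bounded_integrable => //.
      by rewrite ltey_eq fin_measure.
    by exists `|r|; split; [exact: num_real|move=> M hM x _ /=; exact: ltW].
  have h1 : (\int[mu]_(x in D i) (c i - e)%:E <= \int[mu]_(x in D i) (f x)%:E)%E.
    apply: le_integral => //; first exact: ci.
    by move=> x /set_mem Dx; rewrite lee_fin; have := fc Dx; rewrite ler_norml; lra.
  have h2 : (\int[mu]_(x in D i) (f x)%:E <= \int[mu]_(x in D i) (c i + e)%:E)%E.
    apply: le_integral => //; first exact: ci.
    by move=> x /set_mem Dx; rewrite lee_fin; have := fc Dx; rewrite ler_norml; lra.
  rewrite integral_cst // -(fineK (fin_measure (mD i))) -(fineK fin) -EFinM lee_fin in h1.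
  rewrite integral_cst // -(fineK (fin_measure (mD i))) -(fineK fin) -EFinM lee_fin in h2.
  by rewrite ler_norml; apply/andP; split; lra.
have [w wP wb] : exists2 w : I -> R, (forall i, \int[mu]_(x in D i) (f x)%:E = (w i)%:E)%E &
    forall i, `|w i - c i * fine (mu (D i))| <= e * fine (mu (D i)).
  have [w wP] := choice (fun i =>
    let: ex_intro2 w a b := bnd i in ex_intro (fun w => _ /\ _) w (conj a b)).
  by exists w => i; case: (wP i).
exists (\sum_i w i).
  rewrite SE integral_bigsetU_EFin //.
  - by rewrite -sumEFin big_enum; apply: eq_bigr => i _; rewrite wP.
  - exact: enum_uniq.
  - by apply: sub_trivIset tD.
  - by rewrite -SE; apply/measurable_EFinP.
rewrite -sumrB mulr_sumr; apply: le_trans (ler_norm_sum _ _ _) _.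
by apply: ler_sum => i _; exact: wb.
Qed.

End finite_partition.

Section grid.
Context (R : realType).
Local Notation mR := (measurableTypeR R).

Definition quadrant (x y : R) : set (mR * mR) := `]-oo, x] `*` `]-oo, y].

(** The empty set, and not the half-line ending at 0, for p = 0: the first strip
thus contains 0 and the strips cover the closed unit interval. *)
Definition level (K p : nat) : set mR :=
  if p is 0 then set0 else `]-oo, (p%:R / K%:R)%R].

Definition strip (K p : nat) : set mR := level K p.+1 `\` level K p.

Lemma measurable_level K p : measurable (level K p).
Proof. by case: p => [|p]; [exact: measurable0|exact: measurable_itv]. Qed.

Lemma measurable_strip K p : measurable (strip K p).
Proof. by apply: measurableD; exact: measurable_level. Qed.

Lemma level_sub K p q : (0 < K)%N -> (p <= q)%N -> level K p `<=` level K q.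
Proof.
move=> K0; case: p => [|p]; first by move=> _; exact: sub0set.
case: q => // q pq x; rewrite /level /= !in_itv /= => /le_trans; apply.
by rewrite ler_pM2r ?invr_gt0 ?ltr0n // ler_nat.
Qed.

Lemma strip_disj K p q x : (0 < K)%N -> strip K p x -> strip K q x -> p = q.
Proof.
move=> K0 [xp xp'] [xq xq']; case: (ltngtP p q) => // h.
  by case: xq'; apply: (level_sub K0 h).
by case: xp'; apply: (level_sub K0 h).
Qed.

Lemma strip_cover K (x : R) : (0 < K)%N -> 0 <= x <= 1 ->
  exists p : 'I_K, strip K p x.
Proof.
move=> K0 /andP[x0 x1]; have KR : 0 < K%:R :> R by rewrite ltr0n.
have ex : exists p, x <= p.+1%:R / K%:R.
  by exists K.-1; rewrite prednK // divff // gt_eqF.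
case: (ex_minnP ex) => p xp pmin.
have pK : (p < K)%N.
  have : (p <= K.-1)%N by apply: pmin; rewrite prednK // divff // gt_eqF.
  by move/leq_ltn_trans; apply; rewrite prednK.
exists (Ordinal pK) => /=; split; first by rewrite /level /= in_itv.
case: p xp pmin pK => [|p] _ pmin _ //=; rewrite in_itv /= => /pmin.
by rewrite ltnn.
Qed.

Definition block (K : nat) (pq : 'I_K * 'I_K) : set (mR * mR) :=
  @unit_square R `&` (strip K pq.1 `*` strip K pq.2).

Lemma measurable_unit_square : measurable (@unit_square R : set (mR * mR)).
Proof. by apply: measurableX. Qed.

Lemma measurable_block K pq : measurable (@block K pq).
Proof.
apply: measurableI; first exact: measurable_unit_square.
by apply: measurableX; exact: measurable_strip.
Qed.

Lemma trivIset_block K : (0 < K)%N -> trivIset setT (@block K).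
Proof.
move=> K0 [p q] [p' q'] _ _ [z [[_ [/= a b]] [_ [/= a' b']]]].
by congr pair; apply: val_inj; [apply: strip_disj a a'|apply: strip_disj b b'].
Qed.

Lemma in_unit_square (z : mR * mR) :
  @unit_square R z <-> (0 <= z.1 <= 1) /\ (0 <= z.2 <= 1).
Proof. by rewrite /unit_square /setX /= !in_itv. Qed.

Lemma block_cover K : (0 < K)%N -> @unit_square R = \bigcup_pq @block K pq.
Proof.
move=> K0; apply/seteqP; split => [z zS|z [pq _ []//]].
have [z1 z2] := (in_unit_square z).1 zS.
have [p hp] := strip_cover K0 z1; have [q hq] := strip_cover K0 z2.
by exists (p, q).
Qed.

Lemma strip_dist K p (x : R) : (0 < K)%N -> 0 <= x -> strip K p x ->
  `|x - p%:R / K%:R| <= K%:R^-1.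
Proof.
move=> K0 x0; rewrite /strip /level /= in_itv /= => -[xp np].
have KR : 0 < K%:R :> R by rewrite ltr0n.
have lo : p%:R / K%:R <= x.
  case: p np {xp} => [|p]; first by rewrite mul0r.
  by rewrite /= in_itv /= => /negP; rewrite -ltNge => /ltW.
rewrite ger0_norm ?subr_ge0 // lerBlDl.
by apply: le_trans xp _; rewrite -natr1 mulrDl mul1r.
Qed.

Section measure_block.
Variable mu : {measure set (mR * mR) -> \bar R}.
Hypothesis mufin : (mu setT < +oo)%E.
Hypothesis mu0 : mu (~` @unit_square R) = 0%E.

Definition level_mass K p q : R := fine (mu (level K p `*` level K q)).

Lemma level_mass0l K q : level_mass K 0 q = 0.
Proof. by rewrite /level_mass /level set0X measure0. Qed.

Lemma level_mass0r K p : level_mass K p 0 = 0.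
Proof. by rewrite /level_mass /level setX0 measure0. Qed.

(** Inclusion-exclusion over the four corners. *)
Lemma block_mass K pq : (0 < K)%N ->
  fine (mu (@block K pq)) =
  level_mass K pq.1.+1 pq.2.+1 - level_mass K pq.1 pq.2.+1
  - (level_mass K pq.1.+1 pq.2 - level_mass K pq.1 pq.2).
Proof.
move=> K0; case: pq => p q /=.
have mX a b : measurable (level K a `*` level K b : set (mR * mR)).
  by apply: measurableX; exact: measurable_level.
have mS a b : measurable (level K a `*` strip K b : set (mR * mR)).
  by apply: measurableX; [exact: measurable_level|exact: measurable_strip].
have mXX : measurable (strip K p `*` strip K q : set (mR * mR)).
  by apply: measurableX; exact: measurable_strip.
have -> : mu (block (p, q)) = mu (strip K p `*` strip K q).
  rewrite [RHS](measureDI mu mXX measurable_unit_square) [X in (X + _)%E](_ : _ = 0%E).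
    by rewrite add0e setIC.
  apply/eqP; rewrite -measure_le0 -mu0; apply: le_measure; rewrite ?inE.
  - by apply: measurableD => //; exact: measurable_unit_square.
  - by apply: measurableC; exact: measurable_unit_square.
  - by move=> z [].
have -> : strip K p `*` strip K q = (level K p.+1 `*` strip K q) `\` (level K p `*` strip K q).
  apply/seteqP; split => z /=; first by move=> [[a b] c]; split => //; case.
  by move=> [[a c] b]; split => //; split => // d; apply: b.
have sl a : level K a `*` strip K q = (level K a `*` level K q.+1) `\` (level K a `*` level K q).
  apply/seteqP; split => z /=; first by move=> [a1 [b c]]; split => //; case.
  by move=> [[a1 c] b]; split => //; split => // d; apply: b.
rewrite fine_measureD //; last by move=> z [/= a b]; split => //; apply: (level_sub K0 (leqnSn p)).
rewrite !sl !fine_measureD //.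
- by rewrite /level_mass; ring.
- by move=> z [/= a b]; split => //; apply: (level_sub K0 (leqnSn q)).
- by move=> z [/= a b]; split => //; apply: (level_sub K0 (leqnSn q)).
Qed.

End measure_block.

Section continuous_on_square.
Variable g : R * R -> R.
Hypothesis cg : {within @unit_square R, continuous g}.

Lemma compact_unit_square : compact (@unit_square R : set (R * R)).
Proof. by apply: compact_setX; exact: segment_compact. Qed.

(** Heine's theorem, from the covering form of compactness. *)
Lemma unif_continuous_square (e : R) : 0 < e -> exists2 d, 0 < d &
  forall z z', @unit_square R z -> @unit_square R z' ->
    `|z.1 - z'.1| < d -> `|z.2 - z'.2| < d -> `|g z - g z'| < e.
Proof.
move=> e0.
have H : \forall d \near at_right 0, @unit_square R `<=`
    (fun z => @unit_square R z -> forall z', @unit_square R z' ->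
    `|z.1 - z'.1| < d -> `|z.2 - z'.2| < d -> `|g z - g z'| < e).
  have /compact_near_coveringP cov := compact_unit_square.
  apply: cov => z zS.
  have e2 : 0 < e / 2 by rewrite divr_gt0.
  have /cvgrPdist_lt/(_ _ e2) := (subspace_continuousP _ _).1 cg z zS.
  rewrite /within /= => /nbhs_ballP[r /= r0 hr].
  have r2 : 0 < r / 2 by rewrite divr_gt0.
  exists (ball z (r / 2), [set d | d < r / 2]).
    split => /=; first exact: nbhsx_ballx.
    by exact: nbhs_right_lt.
  move=> [w d] [/= zw dr0] wS w' w'S w1 w2.
  have dr : d < r / 2 := dr0.
  have [zw1 zw2] : `|z.1 - w.1| < r / 2 /\ `|z.2 - w.2| < r / 2 by case: zw.
  have h1 : `|g z - g w| < e / 2.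
    apply: hr => //; split => /=; apply: lt_trans (_ : r / 2 < r) => //; lra.
  have h2 : `|g z - g w'| < e / 2.
    apply: hr => //; split; rewrite /ball /=.
      by have := ler_distD w.1 z.1 w'.1; lra.
    by have := ler_distD w.2 z.2 w'.2; lra.
  by rewrite distrC in h1; have := ler_distD (g z) (g w) (g w'); lra.
near (at_right (0 : R)) => d; exists d.
  by near: d; exact: nbhs_right_gt.
move=> z z' zS; have : @unit_square R `<=`
    (fun z => @unit_square R z -> forall z', @unit_square R z' ->
    `|z.1 - z'.1| < d -> `|z.2 - z'.2| < d -> `|g z - g z'| < e) by near: d.
by move=> /(_ z zS zS z').
Unshelve. all: by end_near. Qed.

Definition grid_pt (K : nat) (pq : 'I_K * 'I_K) : R * R :=
  (pq.1%:R / K%:R, pq.2%:R / K%:R).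

Lemma grid_pt_square K pq : (0 < K)%N -> @unit_square R (@grid_pt K pq).
Proof.
move=> K0; have KR : 0 < K%:R :> R by rewrite ltr0n.
apply/in_unit_square; split => /=; rewrite divr_ge0 //= ler_pdivrMr // mul1r ler_nat ltnW //.
Qed.

Lemma block_close (e : R) : 0 < e -> \forall K \near \oo,
  forall pq z, @block K pq z -> `|g z - g (grid_pt pq)| <= e.
Proof.
move=> e0; have [d d0 dP] := unif_continuous_square e0.
near=> K.
have K0 : (0 < K)%N by near: K; exact: nbhs_infty_gt.
have KR : 0 < K%:R :> R by rewrite ltr0n.
have big : 2 / d <= K%:R by near: K; exact: nbhs_infty_ger.
have Kd : K%:R^-1 < d.
  rewrite ler_pdivrMr // in big; rewrite -[ltLHS]mul1r ltr_pdivrMr //; lra.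
move=> [p q] z [zS [/= zp zq]].
have [/andP[z1 _] /andP[z2 _]] := (in_unit_square z).1 zS.
apply/ltW/dP => //; first exact: grid_pt_square.
  exact: le_lt_trans (strip_dist K0 z1 zp) Kd.
exact: le_lt_trans (strip_dist K0 z2 zq) Kd.
Unshelve. all: by end_near. Qed.

(** g is a pointwise limit of functions constant on the blocks of a grid. *)
Lemma measurable_on_square : measurable_fun (@unit_square R : set (mR * mR)) g.
Proof.
pose h K (z : mR * mR) : R := \sum_pq g (grid_pt pq) * \1_(@block K pq) z.
apply: (@measurable_fun_cvg _ _ _ _ h) => [K|z zS].
  apply: measurable_sum => pq; apply: measurable_funM => //.
  apply: measurable_indic; exact: measurable_block.
apply/cvgrPdist_le => e e0; near=> K.
have K0 : (0 < K)%N by near: K; exact: nbhs_infty_gt.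
have [pq _ zpq] : (\bigcup_pq @block K pq) z by rewrite -block_cover.
have -> : h K z = g (grid_pt pq).
  rewrite /h (bigD1 pq) //= indicE mem_set // mulr1 big1 ?addr0 // => pq' ne.
  rewrite indicE memNset ?mulr0 // => zpq'.
  by case/eqP: ne; apply: (trivIset_block K0) => //; exists z.
have : forall pq z, @block K pq z -> `|g z - g (grid_pt pq)| <= e.
  by near: K; exact: block_close.
exact.
Unshelve. all: by end_near. Qed.

End continuous_on_square.

(** For a fine grid, every integral is close to a Riemann sum whose weights are
the masses of the blocks.  By [block_mass] these masses are combinations of
values of the distribution function at grid points, hence converge. *)
Lemma weak_cvg_of_cdf (m_ : nat -> {measure set (mR * mR) -> \bar R})
    (m : {measure set (mR * mR) -> \bar R}) :
  (forall n, (m_ n setT < +oo)%E) -> (m setT < +oo)%E ->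
  (forall n, m_ n (~` @unit_square R) = 0%E) -> m (~` @unit_square R) = 0%E ->
  (forall K p q, (0 < K)%N -> (0 < p <= K)%N -> (0 < q <= K)%N ->
    fine (m_ n (quadrant (p%:R / K%:R) (q%:R / K%:R))) @[n --> \oo] -->
    fine (m (quadrant (p%:R / K%:R) (q%:R / K%:R)))) ->
  weak_cvg m_ m.
Proof.
move=> fin_ fin null_ null cdf g cg.
have mg := measurable_on_square cg.
have lm K p q : (0 < K)%N -> (p <= K)%N -> (q <= K)%N ->
    level_mass (m_ n) K p q @[n --> \oo] --> level_mass m K p q.
  move=> K0; case: p => [|p] pK.
    by move=> _; rewrite level_mass0l; under eq_fun do rewrite level_mass0l; exact: cvg_cst.
  case: q => [|q] qK.
    by rewrite level_mass0r; under eq_fun do rewrite level_mass0r; exact: cvg_cst.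
  exact: cdf.
have bm K pq : (0 < K)%N ->
    fine (m_ n (@block K pq)) @[n --> \oo] --> fine (m (@block K pq)).
  move=> K0; rewrite block_mass //; under eq_fun do rewrite block_mass //.
  have [p1 p2] : (pq.1 < K)%N /\ (pq.2 < K)%N by split; exact: ltn_ord.
  by apply: cvgB; apply: cvgB; apply: lm => //; exact: ltnW.
pose S (mu : set (mR * mR) -> \bar R) K := \sum_pq g (grid_pt pq) * fine (mu (@block K pq)).
pose M (mu : set (mR * mR) -> \bar R) K := \sum_pq fine (mu (@block K pq)).
have key (mu : {measure set (mR * mR) -> \bar R}) K e : (mu setT < +oo)%E -> (0 < K)%N ->
    (forall pq z, @block K pq z -> `|g z - g (grid_pt pq)| <= e) ->
    exists2 v, (\int[mu]_(x in @unit_square R) (g x)%:E = v%:E)%E & `|v - S mu K| <= e * M mu K.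
  move=> muf K0 hg.
  apply: (integral_partition muf _ (trivIset_block K0) (block_cover K0) mg hg).
  by move=> pq; exact: measurable_block.
have K1 : \forall K \near \oo, (0 < K)%N by exact: nbhs_infty_gt.
have int_fin (mu : {measure set (mR * mR) -> \bar R}) : (mu setT < +oo)%E ->
    (\int[mu]_(x in @unit_square R) (g x)%:E)%E \is a fin_num.
  move=> muf; near \oo => K.
  have K0 : (0 < K)%N by near: K.
  have hg : forall pq z, @block K pq z -> `|g z - g (grid_pt pq)| <= 1.
    by near: K; exact: block_close.
  by have [v -> _] := key mu K 1 muf K0 hg.
rewrite -(fineK (int_fin m fin)); apply/fine_cvgP; split.
  by apply: nearW => n; exact: int_fin.
apply/cvgrPdist_le => e e0.
(* the blocks have total mass at most m setT for m, and
   for large n at most 1 more for m_ n *)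
pose e' := e / (4 * (fine (m setT) + 1)).
have mT : 0 <= fine (m setT) by rewrite fine_ge0.
have e'0 : 0 < e' by rewrite divr_gt0 // mulr_gt0 //; lra.
near \oo => K.
have K0 : (0 < K)%N by near: K.
have hg : forall pq z, @block K pq z -> `|g z - g (grid_pt pq)| <= e'.
  by near: K; exact: block_close.
have SK : S (m_ n) K @[n --> \oo] --> S m K.
  apply: cvg_big => [|pq _]; first exact: add_continuous.
  by apply: cvgMr; exact: bm.
have MK : M (m_ n) K @[n --> \oo] --> M m K.
  by apply: cvg_big => [|pq _]; [exact: add_continuous|exact: bm].
have MT : M m K <= fine (m setT).
  have m1 : measurable_fun (@unit_square R : set (mR * mR)) (cst (1 : R)) by exact: measurable_cst.
  have c1 pq (z : mR * mR) : @block K pq z -> `|cst (1 : R) z - cst 1 pq| <= 0.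
    by move=> _; rewrite subrr normr0.
  have [v] := integral_partition fin (@measurable_block K) (trivIset_block K0)
    (block_cover K0) m1 c1.
  have hc := integral_cst m measurable_unit_square 1%E; rewrite mul1e in hc.
  move=> /(etrans (esym hc)) hv; rewrite mul0r normr_le0 subr_eq0 => /eqP.
  under eq_bigr do rewrite mul1r.
  rewrite /M => <-; rewrite -[v]/(fine v%:E) -hv fine_le ?fin_measure //.
    exact: measurable_unit_square.
  by rewrite le_measure ?inE //; exact: measurable_unit_square.
near=> n.
have [v hv vS] := key m K e' fin K0 hg.
have [vn hvn vnS] := key (m_ n) K e' (fin_ n) K0 hg.
rewrite /comp /= hv hvn /=.
have h1 : `|S m K - S (m_ n) K| <= e / 4.
  by near: n; move/cvgrPdist_le : SK; apply; rewrite divr_gt0.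
have h2 : `|M m K - M (m_ n) K| <= 1.
  by near: n; move/cvgrPdist_le : MK; apply.
have h3 : e' * (M m K + M (m_ n) K) <= e / 2.
  have -> : e / 2 = e' * (2 * (fine (m setT) + 1)).
    by rewrite /e'; field; rewrite gt_eqF //; lra.
  rewrite ler_pM2l //; move: h2; rewrite ler_norml; lra.
move: vS vnS h1; rewrite !ler_norml; lra.
Unshelve. all: by end_near. Qed.

End grid.

(** * Distribution function of the measure of a permutation *)

Section perm_cdf.
Context (R : realType).
Local Notation mR := (measurableTypeR R).
Local Notation leb := (@lebesgue_measure R).
Local Notation leb2 := (leb \x leb)%E.

Lemma leb_segment (a b : R) : a <= b -> leb `[a, b] = (b - a)%:E.
Proof.
rewrite le_eqVlt => /orP[/eqP ->|ab].
  by rewrite set_itv1 lebesgue_measure_set1 subrr.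
by rewrite lebesgue_measure_itv /= lte_fin ab EFinB.
Qed.

Lemma leb2_rect (a b c d : R) : a <= b -> c <= d ->
  leb2 (`[a, b] `*` `[c, d]) = ((b - a) * (d - c))%:E.
Proof.
move=> ab cd; transitivity (leb `[a, b] * leb `[c, d])%E.
  exact: product_measure1E.
by rewrite (leb_segment ab) (leb_segment cd) EFinM.
Qed.

Lemma step_size n i : (0 < n)%N -> i.+1%:R / n%:R - i%:R / n%:R = n%:R^-1 :> R.
Proof. by move=> n0; rewrite -mulrBl -natrB // subSnn mul1r. Qed.

Lemma step_le n i : i%:R / n%:R <= i.+1%:R / n%:R :> R.
Proof. by rewrite ler_wpM2r ?invr_ge0 // ler_nat. Qed.

Lemma leb2_cell n i j : (0 < n)%N -> leb2 (@cell R n i j) = (n%:R^-1 * n%:R^-1)%:E.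
Proof. by move=> n0; rewrite /cell leb2_rect ?step_le // !step_size. Qed.

Section one_perm.
Variables (n : nat) (s : 'S_n).

Definition cell_mass (A : set (mR * mR)) (i : 'I_n) : R :=
  n%:R * fine (leb2 (A `&` @cell R n i (s i))).

Let n0 (i : 'I_n) : (0 < n)%N := leq_ltn_trans (leq0n i) (ltn_ord i).

Lemma leb2_cell_fin A (i : 'I_n) : measurable A ->
  (leb2 (A `&` @cell R n i (s i)) <= (n%:R^-1 * n%:R^-1)%:E)%E.
Proof.
move=> mA; rewrite -(leb2_cell i (s i) (n0 i)); apply: le_measure; rewrite ?inE.
- by apply: measurableI => //; exact: measurable_cell.
- exact: measurable_cell.
- exact: subIsetr.
Qed.

Lemma leb2_cell_fin_num A (i : 'I_n) : measurable A ->
  leb2 (A `&` @cell R n i (s i)) \is a fin_num.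
Proof.
move=> mA; rewrite ge0_fin_numE //; apply: le_lt_trans (leb2_cell_fin i mA) _.
exact: ltry.
Qed.

Lemma perm_measureE A : measurable A ->
  perm_measure s A = (\sum_i cell_mass A i)%:E.
Proof.
move=> mA; rewrite /perm_measure -sumEFin; apply: eq_bigr => i _.
by rewrite /cell_mass EFinM fineK // leb2_cell_fin_num.
Qed.

Lemma cell_mass_ge0 A i : 0 <= cell_mass A i.
Proof. by rewrite /cell_mass mulr_ge0 // fine_ge0. Qed.

Lemma cell_mass_le A i : measurable A -> cell_mass A i <= n%:R^-1.
Proof.
move=> mA; have nR : 0 < n%:R :> R by rewrite ltr0n (n0 i).
rewrite /cell_mass -ler_pdivlMl // -lee_fin fineK; last exact: leb2_cell_fin_num.
exact: leb2_cell_fin.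
Qed.

Lemma cell_mass_sub A (i : 'I_n) : @cell R n i (s i) `<=` A -> cell_mass A i = n%:R^-1.
Proof.
move=> /setIidr cA; rewrite /cell_mass cA leb2_cell ?(n0 i) //=.
by rewrite mulrA mulfV ?mul1r // pnatr_eq0 -lt0n (n0 i).
Qed.

(** For cells that meet the set at most along a segment. *)
Lemma cell_mass_null A (i : 'I_n) (B : set (mR * mR)) : measurable A ->
  measurable B -> leb2 B = 0%E -> A `&` @cell R n i (s i) `<=` B -> cell_mass A i = 0.
Proof.
move=> mA mB B0 AB; rewrite /cell_mass.
have -> : leb2 (A `&` @cell R n i (s i)) = 0%E.
  apply/eqP; rewrite -measure_le0 -B0; apply: le_measure; rewrite ?inE //.
  by apply: measurableI => //; exact: measurable_cell.
by rewrite mulr0.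
Qed.

Lemma perm_measure_fin : (perm_measure (R := R) s setT < +oo)%E.
Proof. by rewrite perm_measureE // ltry. Qed.

Lemma perm_measure_square : perm_measure s (~` @unit_square R) = 0%E.
Proof.
have mS : measurable (~` @unit_square R : set (mR * mR)).
  by apply: measurableC; exact: measurable_unit_square.
rewrite perm_measureE // big1 // => i _.
apply: (@cell_mass_null _ _ set0) => // z [zS].
rewrite /cell /= !in_itv /= => -[/andP[a b] /andP[c d]]; apply: zS.
have nR : 0 < n%:R :> R by rewrite ltr0n (n0 i).
have top (j : 'I_n) : j.+1%:R / n%:R <= 1 :> R by rewrite ler_pdivrMr // mul1r ler_nat.
have bot (j : 'I_n) : 0 <= j%:R / n%:R :> R by rewrite divr_ge0.
apply/in_unit_square; split; apply/andP; split.
- exact: le_trans (bot i) a.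
- exact: le_trans b (top i).
- exact: le_trans (bot (s i)) c.
- exact: le_trans d (top (s i)).
Qed.

Lemma measurable_quadrant x y : measurable (@quadrant R x y).
Proof. by apply: measurableX. Qed.

(** A cell inside the quadrant contributes 1 / n to both terms and a cell beyond
its boundary lines contributes to neither.  The difference comes from the cells
that a boundary line crosses: the one in column [truncn (n x)] and the one in row
[truncn (n y)]. *)
Lemma perm_cdf_hits (x y : R) : (0 < n)%N -> 0 <= x -> 0 <= y ->
  `|fine (perm_measure s (quadrant x y)) - hits_at s x y| <= 2 / n%:R.
Proof.
move=> n1 x0 y0; have nR : 0 < n%:R :> R by rewrite ltr0n.
have mQ := measurable_quadrant x y.
rewrite perm_measureE //= /hits_at.
have nx0 : 0 <= n%:R * x by rewrite mulr_ge0.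
have ny0 : 0 <= n%:R * y by rewrite mulr_ge0.
have /andP[k1 k2] := truncn_itv nx0; have /andP[l1 l2] := truncn_itv ny0.
set k := Num.truncn (n%:R * x) in k1 k2 *; set l := Num.truncn (n%:R * y) in l1 l2 *.
pose hit (i : 'I_n) := (i < k)%N && (s i < l)%N.
have -> : (hits s k l)%:R / n%:R = \sum_(i | hit i) n%:R^-1 :> R.
  rewrite sumr_const -[RHS]mulr_natl; congr (_%:R * _).
  by apply: eq_card => i; rewrite !inE.
have hitE i : hit i -> cell_mass (quadrant x y) i = n%:R^-1.
  case/andP => ik sl; apply: cell_mass_sub => z.
  rewrite /cell /quadrant /= !in_itv /= => -[/andP[_ a] /andP[_ b]]; split.
    apply: le_trans a _; rewrite ler_pdivrMr // mulrC; apply: le_trans k1.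
    by rewrite ler_nat.
  apply: le_trans b _; rewrite ler_pdivrMr // mulrC; apply: le_trans l1.
  by rewrite ler_nat.
have offx (i : 'I_n) : (k < i)%N -> cell_mass (quadrant x y) i = 0.
  move=> ki; apply: (@cell_mass_null _ _
    (`[x, x] `*` `[(s i)%:R / n%:R, (s i).+1%:R / n%:R])) => //.
  - by apply: measurableX.
  - by rewrite leb2_rect ?step_le // subrr mul0r.
  - move=> z; rewrite /cell /quadrant /= !in_itv /= => -[[a _] [/andP[b _] c]].
    split => //; rewrite a andbT; apply: le_trans b.
    rewrite ler_pdivlMr // mulrC; apply: le_trans (ltW k2) _.
    by rewrite ler_nat.
have offy (i : 'I_n) : (l < s i)%N -> cell_mass (quadrant x y) i = 0.
  move=> ki; apply: (@cell_mass_null _ _ (`[i%:R / n%:R, i.+1%:R / n%:R] `*` `[y, y])) => //.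
  - by apply: measurableX.
  - by rewrite leb2_rect ?step_le // subrr mulr0.
  - move=> z; rewrite /cell /quadrant /= !in_itv /= => -[[_ a] [c /andP[b _]]].
    split => //; rewrite a andbT; apply: le_trans b.
    rewrite ler_pdivlMr // mulrC; apply: le_trans (ltW l2) _.
    by rewrite ler_nat.
rewrite (bigID hit) /= (eq_bigr _ hitE) addrAC subrr add0r ger0_norm; last first.
  by apply: sumr_ge0 => i _; exact: cell_mass_ge0.
have one (m : nat) : \sum_(i < n) ((i == m :> nat)%:R : R) <= 1.
  have [mn|nm] := ltnP m n.
    rewrite (bigD1 (Ordinal mn)) //= eqxx big1 ?addr0 // => i /negbTE h.
    by rewrite -val_eqE /= in h; rewrite h.
  by rewrite big1 // => i _; rewrite ltn_eqF // (leq_trans (ltn_ord i)).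
have ones : \sum_(i < n) ((s i == l :> nat)%:R : R) <= 1.
  by have := one l; rewrite (reindex_inj (@perm_inj _ s)).
apply: (@le_trans _ _ (\sum_(i < n) n%:R^-1 * ((i == k :> nat)%:R + (s i == l :> nat)%:R))).
  rewrite big_mkcond; apply: ler_sum => i _.
  have i0 : 0 <= n%:R^-1 :> R by rewrite invr_ge0.
  case: ifP => [|_]; last by rewrite mulr_ge0 ?addr_ge0.
  rewrite negb_and -!leqNgt => nh.
  have [ki|] := ltnP k i; first by rewrite offx ?mulr_ge0 ?addr_ge0.
  have [ls|] := ltnP l (s i); first by rewrite offy ?mulr_ge0 ?addr_ge0.
  move=> sl ik; apply: le_trans (cell_mass_le i mQ) _.
  rewrite ler_peMr //.
  have : (i == k :> nat) || (s i == l :> nat).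
    by case/orP: nh => h; apply/orP; [left|right]; rewrite eqn_leq ?ik ?sl h.
  by case: (i == k :> nat); case: (s i == l :> nat) => //= _; rewrite ?addr0 ?add0r // lerDl.
rewrite -mulr_sumr big_split /= mulrC ler_pM2r ?invr_gt0 //.
by have := one k; lra.
Qed.

End one_perm.

End perm_cdf.

(** * Distribution functions of the limits *)

Section laws.
Context (R : realType).
Local Notation mR := (measurableTypeR R).
Local Notation leb := (@lebesgue_measure R).

Lemma leb01E (A : set mR) : leb01 R A = leb (A `&` `[0, 1]).
Proof. by []. Qed.

Lemma leb01T : leb01 R setT = 1%E.
Proof. by rewrite leb01E setTI leb_segment // subr0. Qed.

(** The half-lines ]x, +oo[ form a generating family stable by intersection, and
the masses of their complements are given. *)
Lemma finite_measure_unique (m1 m2 : {measure set mR -> \bar R}) :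
  (m1 setT < +oo)%E -> m1 setT = m2 setT ->
  (forall x : R, m1 `]-oo, x]%classic = m2 `]-oo, x]%classic) ->
  forall A, measurable A -> m1 A = m2 A.
Proof.
move=> fin1 mT m12; have fin2 : (m2 setT < +oo)%E by rewrite -mT.
apply: (@measure_unique _ R mR (@RGenOInfty.G R) (fun k : nat => `](- (k%:R : R))%R, +oo[%classic)).
- exact: RGenOInfty.measurableE.
- move=> _ _ [x ->] [y ->]; exists (Num.max x y).
  by apply/seteqP; split => z /=; rewrite !in_itv /= !andbT gt_max => /andP.
- by move=> k; exists (- k%:R).
- apply/seteqP; split => // x _.
  exists (Num.truncn `|x|).+1 => //=; rewrite in_itv /= andbT ltrNl.
  apply: le_lt_trans (ler_norm _) _; rewrite normrN.
  by have /andP[] := truncn_itv (normr_ge0 x).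
- move=> _ [x ->]; rewrite -setCitvl -setTD.
  have mI : measurable (`]-oo, x] : set mR) by exact: measurable_itv.
  rewrite !measureD ?fin1 ?fin2 // !setTI.
  by congr (_ - _)%E; [exact: mT|exact: m12].
- move=> k; apply: le_lt_trans fin1; apply: le_measure; rewrite ?inE //.
Qed.

Lemma uniform_marginal d (T : measurableType d) (m : {measure set T -> \bar R})
    (phi : {mfun T >-> mR}) :
  m setT = 1%E -> m (phi @^-1` (~` `[0, 1]%classic)) = 0%E ->
  (forall x : R, 0 <= x <= 1 -> m (phi @^-1` `]-oo, x]%classic) = x%:E) ->
  forall A : set mR, measurable A -> m (phi @^-1` A) = leb (A `&` `[0, 1]).
Proof.
move=> mT m0 mx A mA.
have mphi : measurable_fun setT phi by [].
have mpre (B : set mR) : measurable B -> measurable (phi @^-1` B).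
  by move=> mB; rewrite -[X in measurable X]setTI; exact: mphi.
rewrite -/(pushforward m phi A) -leb01E.
apply: (finite_measure_unique
  (m1 := measure_function_pushforward__canonical__measure_function_Measure m mphi)
  (m2 := leb01 R)) => //=.
- by rewrite /pushforward preimage_setT mT ltry.
- by rewrite [RHS]leb01T /pushforward preimage_setT.
move=> x; rewrite /pushforward [RHS]leb01E.
have m01 : measurable (~` `[0, 1] : set mR) by apply: measurableC.
have [x0|x0] := ltP x 0.
  rewrite (_ : `]-oo, x] `&` _ = set0) ?measure0; last first.
    by apply/seteqP; split => z //=; rewrite !in_itv /=; lra.
  apply/eqP; rewrite -measure_le0 -m0; apply: le_measure; rewrite ?inE.
  - by apply: mpre.
  - by apply: mpre.
  - by move=> z /=; rewrite !in_itv /= => zx; apply/negP; lra.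
have [x1|x1] := leP x 1.
  rewrite mx ?x0 // (_ : `]-oo, x] `&` _ = `[0, x]%classic); last first.
    by apply/seteqP; split => z /=; rewrite !in_itv /=; lra.
  by rewrite leb_segment // subr0.
rewrite (_ : `]-oo, x] `&` _ = `[0, 1]%classic); last first.
  by apply/seteqP; split => z /=; rewrite !in_itv /=; lra.
rewrite leb_segment // subr0 -mT.
have mX : measurable (phi @^-1` `]-oo, x]%classic) by apply: mpre.
rewrite -[in RHS](setvU (phi @^-1` `]-oo, x]%classic)) measureU //; last 2 first.
- exact: measurableC.
- by rewrite setICl.
rewrite [X in (X + _)%E](_ : _ = 0%E) ?add0e //.
apply/eqP; rewrite -measure_le0 -m0; apply: le_measure; rewrite ?inE.
- exact: measurableC.
- by apply: mpre.
- by move=> z /=; rewrite !in_itv /= => /negP zx; apply/negP; lra.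
Qed.

(** The marginal distribution functions are the values of F on the edges x = 1
and y = 1; outside the unit interval they are fixed by the support. *)
Lemma permuton_of_cdf (m : {measure set (mR * mR) -> \bar R}) (F : R -> R -> R) :
  m (~` @unit_square R) = 0%E ->
  (forall x y, 0 <= x <= 1 -> 0 <= y <= 1 -> m (quadrant x y) = (F x y)%:E) ->
  (forall x, 0 <= x <= 1 -> F x 1 = x /\ F 1 x = x) ->
  is_permuton m.
Proof.
move=> m0 mF F1.
have null_eq (A B : set (mR * mR)) : measurable A -> measurable B ->
    A `&` @unit_square R = B `&` @unit_square R -> m A = m B.
  move=> mA mB AB.
  have mS := @measurable_unit_square R.
  have e (C : set (mR * mR)) : measurable C -> m C = m (C `&` @unit_square R).
    move=> mC; rewrite [LHS](measureDI m mC mS) [X in (X + _)%E](_ : _ = 0%E) ?add0e //.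
    apply/eqP; rewrite -measure_le0 -m0; apply: le_measure; rewrite ?inE.
    - exact: measurableD.
    - exact: measurableC.
    - by move=> z [].
  by rewrite (e A) // (e B) // AB.
have u01 : 0 <= (1 : R) <= 1 by rewrite ler01 lexx.
have mQ x y : measurable (@quadrant R x y) by exact: measurable_quadrant.
have mT : m setT = 1%E.
  rewrite (@null_eq _ (quadrant 1 1)) //; first by rewrite mF // (F1 1 u01).1.
  apply/seteqP; split => z [_ zS]; split => //.
  by case: (in_unit_square z).1 => // /andP[_ a] /andP[_ b]; split; rewrite /= in_itv.
have pre_null (phi : {mfun (mR * mR)%type >-> mR}) :
   (forall z, @unit_square R z -> 0 <= phi z <= 1) -> m (phi @^-1` (~` `[0, 1]%classic)) = 0%E.
  move=> h; rewrite (@null_eq _ set0) ?measure0 //.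
    rewrite -[X in measurable X]setTI; apply: (measurable_funPT phi) => //.
    exact: measurableC.
  by apply/seteqP; split => z // [a zS]; case: a => /=; rewrite in_itv /=; exact: h.
split => //.
- move=> A mA; rewrite (_ : A `*` setT = fst @^-1` A); last by apply/seteqP; split => z //= [].
  have mf : measurable_fun setT (fst : mR * mR -> mR) by exact: measurable_fst.
  pose phi := mfun_Sub (mem_set mf).
  rewrite -[fst]/(phi : _ -> _).
  apply: (uniform_marginal (phi := phi)) => //.
    by apply: pre_null => z /in_unit_square[].
  move=> x x01; rewrite -[in RHS](F1 x x01).1 -mF //; apply: null_eq => //.
    by rewrite -[X in measurable X]setTI; apply: (measurable_funPT phi).
  apply/seteqP; split => z [/= a zS]; split => //; last by case: a.
  by split => //=; rewrite in_itv /=; case: (in_unit_square z).1 => // _ /andP[].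
- move=> A mA; rewrite (_ : setT `*` A = snd @^-1` A); last by apply/seteqP; split => z //= [].
  have mf : measurable_fun setT (snd : mR * mR -> mR) by exact: measurable_snd.
  pose phi := mfun_Sub (mem_set mf).
  rewrite -[snd]/(phi : _ -> _).
  apply: (uniform_marginal (phi := phi)) => //.
    by apply: pre_null => z /in_unit_square[].
  move=> x x01; rewrite -[in RHS](F1 x x01).2 -mF //; apply: null_eq => //.
    by rewrite -[X in measurable X]setTI; apply: (measurable_funPT phi).
  apply/seteqP; split => z [/= a zS]; split => //; last by case: a.
  by split => //=; rewrite in_itv /=; case: (in_unit_square z).1 => // /andP[].
Qed.

Section diagonal.

Lemma diagonal_cdf x y : 0 <= x <= 1 -> 0 <= y <= 1 ->
  diagonal_permuton R (quadrant x y) = (Num.min x y)%:E.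
Proof.
move=> x01 y01; rewrite /= /push_graph /pushforward leb01E.
rewrite (_ : _ `&` _ = `[0, Num.min x y]%classic).
  by rewrite leb_segment ?subr0 // le_min; lra.
by apply/seteqP; split => z /=; rewrite /quadrant /= !in_itv /= le_min; lra.
Qed.

Lemma diagonal_null : diagonal_permuton R (~` @unit_square R) = 0%E.
Proof.
rewrite /= /push_graph /pushforward leb01E (_ : _ `&` _ = set0) ?measure0 //.
apply/seteqP; split => z //= [a b]; apply: a; rewrite /unit_square /=.
by split.
Qed.

Lemma diagonal_is_permuton : is_permuton (diagonal_permuton R).
Proof.
apply: (permuton_of_cdf diagonal_null diagonal_cdf) => x /andP[x0 x1].
by rewrite minC; split; apply/min_idPr.
Qed.

End diagonal.

Section skew.
Variable beta : R.
Hypothesis beta0 : 0 < beta.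
Local Notation G := (rhoint beta).
Local Notation f := (@f321 R beta).

Lemma rho321_measure_segment (A : set mR) (a : R) : measurable A -> 0 <= a <= 1 ->
  A `&` `[0, 1] = `[0, a]%classic -> rho321_measure beta A = (G a)%:E.
Proof.
move=> mA /andP[a0 a1] AE.
have m01 : measurable (`[0, 1] : set mR) by [].
have mrho B : measurable_fun (B : set mR) (EFin \o rho321 beta).
  by apply/measurable_EFinP; apply: measurable_funTS; exact: measurable_rho321.
rewrite (measureDI (rho321_measure beta) mA m01) AE.
rewrite [X in (X + _)%E](_ : _ = 0%E); last first.
  apply: null_set_integral => //; first exact: measurableD.
  rewrite leb01E (_ : _ `&` _ = set0) ?measure0 //.
  by apply/seteqP; split => z // [[]].
rewrite add0e /= /rho321_measure.
rewrite (@eq_measure_integral _ _ _ _ leb); last first.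
  move=> B mB BA; rewrite leb01E setIidl //; apply: subset_trans BA _.
  by rewrite -AE; exact: subIsetr.
move: a0; rewrite le_eqVlt => /orP[/eqP <-|a0].
  by rewrite set_itv1 integral_set1 rhoint0.
rewrite (@continuous_FTC2 _ _ G) ?rhoint0 ?sube0 //.
- apply: continuous_subspaceT => x; rewrite /rho321.
  apply: cvgV; first by rewrite gt_eqF // ltr_wpDr ?expR_ge0.
  apply: cvgD; first exact: cvg_cst.
  apply: continuous_comp; last exact: continuous_expR.
  by apply: cvgM; [exact: cvg_cst|apply: cvgB; [exact: cvg_cst|exact: cvg_id]].
- split.
  + by move=> x _; have [] := is_derive_rhoint beta0 x.
  + by apply: cvg_at_right_filter; exact: continuous_rhoint.
  + by apply: cvg_at_left_filter; exact: continuous_rhoint.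
- by move=> x _; rewrite derive1E; have [_ ->] := is_derive_rhoint beta0 x.
Qed.

(** The intermediate value theorem; the value lies in [0, 1/2] because G is
increasing and 1-Lipschitz with G(1) = 1/2. *)
Lemma rhoint_compl y : 0 <= y <= 1 -> exists2 u, 0 <= u <= 1 & G u = y - G y.
Proof.
move=> /andP[y0 y1].
have s0 := rhoint_slope beta0 y0; have s1 := rhoint_slope beta0 y1.
rewrite rhoint0 // rhoint1 // in s0 s1.
have [] := @IVT R G 0 1 (y - G y) ler01.
- by apply: continuous_subspaceT; exact: continuous_rhoint.
- by rewrite rhoint0 // rhoint1 // minEle maxEle invr_ge0 ler0n; lra.
by move=> u; rewrite in_itv /= => u01 e; exists u.
Qed.

(** By [f321_le] the condition [f u <= y] is G(u) <= y - G(y), that is u <= v for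
the v given by [rhoint_compl]. *)
Lemma mu321_half x y : 0 <= x <= 1 -> 0 <= y <= 1 ->
  rho321_measure beta [set u | u <= x /\ f u <= y] = (Num.min (G x) (y - G y))%:E.
Proof.
move=> x01 y01; have [u u01 Gu] := rhoint_compl y01.
rewrite (@rho321_measure_segment _ (Num.min x u)).
- rewrite -Gu; congr EFin.
  case: (leP x u) => h; case: (leP (G x) (G u)); rewrite ?ler_rhoint // => h'.
  + by rewrite ltNge ler_rhoint // h in h'.
  + by apply/eqP; rewrite eq_le !ler_rhoint // h' ltW.
- rewrite (_ : [set _ | _] = `]-oo, x] `&` (f @^-1` `]-oo, y])).
    apply: measurableI => //.
    by rewrite -[X in measurable X]setTI; apply: measurable_f321.
  by apply/seteqP; split => z /=; rewrite !in_itv.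
- by rewrite le_min ge_min; lra.
- apply/seteqP; split => z /=; rewrite !in_itv /= le_min.
    move=> [[zx fz] z01]; move: fz; rewrite f321_le // => h.
    have : G z <= G u by lra.
    by rewrite ler_rhoint //; lra.
  move=> /and3P[z0 zx zu]; have z01 : 0 <= z <= 1 by lra.
  split => //; split => //; rewrite f321_le //.
  have : G z <= G u by rewrite ler_rhoint.
  lra.
Qed.

Lemma mu321E A : mu321 beta A =
  (rho321_measure beta ((fun x : mR => (x, f x)) @^-1` A) +
   rho321_measure beta ((fun x : mR => (f x, x)) @^-1` A))%E.
Proof. exact: measure_addE. Qed.

(** By [mu321_half] the value is min(G(x), y - G(y)) + min(G(y), x - G(x)).
The two minima cannot both be their second entries unless x = y = G(x) + G(y),
because G(x) + G(y) <= (x + y) / 2. *)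
Lemma mu321_cdf x y : 0 <= x <= 1 -> 0 <= y <= 1 ->
  mu321 beta (quadrant x y) = (cdf321 beta x y)%:E.
Proof.
move=> x01 y01; rewrite mu321E.
rewrite (_ : _ @^-1` _ = [set u | u <= x /\ f u <= y]); last first.
  by apply/seteqP; split => z /=; rewrite /quadrant /= !in_itv.
rewrite (_ : _ @^-1` _ = [set u | u <= y /\ f u <= x]); last first.
  by apply/seteqP; split => z /=; rewrite /quadrant /= !in_itv /= => -[].
rewrite !mu321_half // -EFinD /cdf321; congr EFin.
have hx := rhoint_le_half beta0 x01; have hy := rhoint_le_half beta0 y01.
case: (leP (G x) (y - G y)) => h1; case: (leP (G y) (x - G x)) => h2;
  case: (leP x y) => h3; case: leP => h4; lra.
Qed.

Lemma f321_01 u : 0 <= u <= 1 -> 0 <= f u <= 1.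
Proof.
move=> u01; have u1 : f u <= 1.
  rewrite f321_le // rhoint1 //; have := rhoint_le_half beta0 u01; lra.
rewrite u1 andbT leNgt; apply/negP => fu0.
(* [f321_le] at y = f u gives G u + G (f u) <= f u, but G u >= 0 and, as G has
   slope below 1, G (f u) > f u *)
have := f321_le beta0 (f u) u01; rewrite lexx => /esym.
have s := rhoint_slope beta0 (ltW fu0).
have [z _ e] := rhoint_mvt beta0 (ltW fu0); have := rho321_bounds beta z => zb.
have : 0 <= G u by rewrite -[leLHS](@rhoint0 R beta) ler_rhoint //; case/andP: u01.
rewrite rhoint0 // in e s.
move=> Gu h; have : f u * (1 - rho321 beta z) < 0 by rewrite nmulr_rlt0 // subr_gt0; case/andP: zb.
move: e; lra.
Qed.

Lemma mu321_null : mu321 beta (~` @unit_square R) = 0%E.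
Proof.
have out (A : set mR) : measurable A -> (forall u, A u -> ~ (0 <= u <= 1)) ->
    rho321_measure beta A = 0%E.
  move=> mA h; apply: null_set_integral => //.
    by apply/measurable_EFinP; apply: measurable_funTS; exact: measurable_rho321.
  rewrite leb01E (_ : _ `&` _ = set0) ?measure0 //.
  by apply/seteqP; split => z // [/h a]; rewrite /= in_itv.
have mS : measurable (~` @unit_square R : set (mR * mR)).
  by apply: measurableC; exact: measurable_unit_square.
rewrite mu321E !out ?adde0 //.
- rewrite -[X in measurable X]setTI.
  apply: (measurable_fun_pair (measurable_f321 beta) (@measurable_id _ _ setT)) => //.
- by move=> u /= uS u01; apply: uS; apply/in_unit_square; split => //=; exact: f321_01.
- rewrite -[X in measurable X]setTI.
  apply: (measurable_fun_pair (@measurable_id _ _ setT) (measurable_f321 beta)) => //.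
- by move=> u /= uS u01; apply: uS; apply/in_unit_square; split => //=; exact: f321_01.
Qed.

Lemma mu321_is_permuton : is_permuton (mu321 beta).
Proof.
apply: (permuton_of_cdf mu321_null mu321_cdf) => x x01; rewrite /cdf321 rhoint1 //.
have /andP[x0 x1] := x01.
have := rhoint_slope beta0 x1; rewrite rhoint1 // => h.
by split; [rewrite (min_idPl x1)|rewrite (min_idPr x1)]; apply/min_idPl; lra.
Qed.

End skew.

End laws.

(** * Almost sure convergence *)

Section almost_sure.
Context (R : realType) (d : measure_display) (Omega : measurableType d).
Variable P : probability Omega R.

Lemma exp_series_fin (c : R) : 0 < c ->
  (\sum_(0 <= n <oo) (expR (- c * n%:R))%:E < +oo)%E.
Proof.
move=> c0; pose q := expR (- c).
have -> : (fun n => \sum_(0 <= k < n) (expR (- c * k%:R))%:E)%E =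
    (fun n => (series (geometric 1 q) n)%:E).
  apply/funext => n; rewrite /series /= -sumEFin; apply: eq_bigr => k _.
  by rewrite /geometric /= mul1r /q -expRM_natl mulrC.
rewrite EFin_lim ?ltry //; apply: is_cvg_geometric_series.
by rewrite ger0_norm ?expR_ge0 // /q expR_lt1 oppr_lt0.
Qed.

Lemma borel_cantelli_exp (A : nat -> set Omega) :
  (forall n, measurable (A n)) -> exp_small (fun n => fine (P (A n))) ->
  {ae P, forall w, \forall n \near \oo, ~ A n w}.
Proof.
move=> mA [c c0 [N _ hN]].
(* shift the sequence, so that the bound holds at every index *)
pose F n := A (n + N)%N.
have F0 : P (lim_sup_set F) = 0%E.
  apply: lim_sup_set_cvg0 => [k|]; first exact: mA.
  apply: le_lt_trans (exp_series_fin c0).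
  apply: lee_nneseries => // n _.
  apply: (@le_trans _ _ (fine (P (A (n + N)%N)))%:E).
    by rewrite fineK // fin_num_measure.
  rewrite lee_fin; apply: le_trans (hN (n + N)%N _) _; first by rewrite /= leq_addl.
  by rewrite ler_expR !mulNr lerN2 ler_pM2l // ler_nat leq_addr.
exists (lim_sup_set F); split => //.
  apply: bigcap_measurable => [|k _]; first by exists 0%N.
  by apply: bigcup_measurable => j _; exact: mA.
move=> w /= nw k _; apply: contrapT => h; apply: nw; exists (k + N)%N => //= n kn An.
have Nn : (N <= n)%N := leq_trans (leq_addl k N) kn.
apply: h; exists (n - N)%N => /=; first by rewrite leq_subRL // addnC.
by rewrite /F subnK.
Qed.

Variables (beta : R) (tau : forall n : nat, Omega -> 'S_n).
Hypothesis htau : forall n : nat, (0 < n)%N -> is_mallows321 P beta (tau n).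

(** The law of [tau n] is given on singletons; sum over the permutations of the
event. *)
Lemma mallows_event n (E : pred 'S_n) : (0 < n)%N ->
  measurable [set w | E (tau n w)] /\
  P [set w | E (tau n w)] = (mallows_prob beta E)%:E.
Proof.
move=> n0; have [mt pt] := htau n0.
have EE : [set w | E (tau n w)] = \big[setU/set0]_(s <- enum E) (tau n @^-1` [set s]).
  rewrite -bigcup_seq; apply/seteqP; split => w /=.
    by move=> Ew; exists (tau n w) => //=; rewrite mem_enum.
  by move=> [s /=]; rewrite mem_enum => Es ->.
split; first by rewrite EE; apply: bigsetU_measurable => s _; exact: mt.
rewrite EE /mallows_prob -sumEFin -[RHS]big_enum /=.
under [RHS]eq_bigr do rewrite -pt.
rewrite -bigcup_seq measure_fin_bigcup //=.
- by rewrite -fsbig_seq ?enum_uniq.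
- by move=> s s' _ _ [w [/= <- <-]].
Qed.

Variables (F : R -> R -> R) (mu : {measure set (measurableTypeR R * measurableTypeR R) -> \bar R}).
Hypothesis mufin : (mu setT < +oo)%E.
Hypothesis mu0 : mu (~` @unit_square R) = 0%E.
Hypothesis muF : forall x y, 0 <= x <= 1 -> 0 <= y <= 1 -> mu (quadrant x y) = (F x y)%:E.
Hypothesis small : forall x y e, 0 <= x <= 1 -> 0 <= y <= 1 -> 0 < e <= 1 ->
  exp_small (fun n => mallows_prob beta
    [pred s : 'S_n | e < `|hits_at s x y - F x y| ]).

Lemma ae_hits_at x y e : 0 <= x <= 1 -> 0 <= y <= 1 -> 0 < e <= 1 ->
  {ae P, forall w, \forall n \near \oo, `|hits_at (tau n w) x y - F x y| <= e}.
Proof.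
move=> x01 y01 e01.
pose E n : pred 'S_n := [pred s : 'S_n | e < `|hits_at s x y - F x y| ].
(* nothing is assumed about tau 0, so the event of index 0 is made empty *)
pose A n : set Omega := if n is 0%N then set0 else [set w | E n (tau n w)].
have mA n : measurable (A n).
  by case: n => [|n]; [exact: measurable0|exact: (mallows_event _ _).1].
have sA : exp_small (fun n => fine (P (A n))).
  have [c c0 hc] := small x01 y01 e01; exists c => //.
  near=> n; have n0 : (0 < n)%N by near: n; exact: nbhs_infty_gt.
  have := (mallows_event (E n) n0).2.
  have -> : [set w | E n (tau n w)] = A n by rewrite /A; case: (n) n0.
  by move=> ->; near: n.
have [B [mB B0 hB]] := borel_cantelli_exp mA sA.
exists B; split => // w nw; apply: hB => /= h; apply: nw.
near=> n; have n0 : (0 < n)%N by near: n; exact: nbhs_infty_gt.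
have : ~ A n w by near: n.
by rewrite /A; case: (n) n0 => // m _ /=; rewrite leNgt => /negP.
Unshelve. all: by end_near. Qed.

(** Only countably many grid points and error bounds 1 / (l + 1) are involved, so
[ae_hits_at] holds for all of them simultaneously. *)
Lemma ae_permuton_cvg : {ae P, forall w, permuton_cvg (fun n => tau n w) mu}.
Proof.
pose pt (p K : nat) : R := p%:R / K%:R.
pose Q K p q l w := (0 < K)%N -> (0 < p <= K)%N -> (0 < q <= K)%N ->
  \forall n \near \oo, `|hits_at (tau n w) (pt p K) (pt q K) - F (pt p K) (pt q K)| <= l.+1%:R^-1.
have pt01 p K : (0 < K)%N -> (0 < p <= K)%N -> 0 <= pt p K <= 1.
  move=> K0 /andP[_ pK]; rewrite /pt divr_ge0 //= ler_pdivrMr ?ltr0n //.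
  by rewrite mul1r ler_nat.
have aeQ : {ae P, forall w, forall K p q l, Q K p q l w}.
  apply: ae_foralln => K; apply: ae_foralln => p; apply: ae_foralln => q; apply: ae_foralln => l.
  have [h|h] := pselect [/\ (0 < K)%N, (0 < p <= K)%N & (0 < q <= K)%N]; last first.
    by apply: aeW => w K0 pK qK; case: h.
  case: h => K0 pK qK.
  have l01 : 0 < (l.+1%:R^-1 : R) <= 1 by rewrite invr_gt0 ltr0n invf_le1 ?ltr0n // ler1n.
  have [B [mB B0 hB]] := ae_hits_at (pt01 _ _ K0 pK) (pt01 _ _ K0 qK) l01.
  by exists B; split => // w nw; apply: hB => h; apply: nw => _ _ _.
have [B [mB B0 hB]] := aeQ.
exists B; split => // w nw; apply: hB => /= h; apply: nw.
apply: weak_cvg_of_cdf => //.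
- by move=> n; exact: perm_measure_fin.
- by move=> n; exact: perm_measure_square.
move=> K p q K0 pK qK; rewrite muF ?pt01 //=.
apply/cvgrPdist_le => e e0.
pose l := Num.truncn (2 / e).
have le : l.+1%:R^-1 <= e / 2.
  have e20 : 0 <= 2 / e by rewrite divr_ge0 // ltW.
  have /andP[_ lt] := truncn_itv e20.
  by rewrite -[e / 2]invrK invf_div lef_pV2 ?posrE ?divr_gt0 ?ltr0n // ltW.
have hn := h K p q l K0 pK qK.
near=> n; have n0 : (0 < n)%N by near: n; exact: nbhs_infty_gt.
have nR : 0 < n%:R :> R by rewrite ltr0n.
have big : 4 / e <= n%:R by near: n; exact: nbhs_infty_ger.
have n2 : 2 / n%:R <= e / 2.
  by rewrite ler_pdivrMr //; rewrite ler_pdivrMr // in big; lra.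
have h1 : `|hits_at (tau n w) (pt p K) (pt q K) - F (pt p K) (pt q K)| <= l.+1%:R^-1 by near: n.
have /andP[p0 _] := pt01 _ _ K0 pK; have /andP[q0 _] := pt01 _ _ K0 qK.
have := perm_cdf_hits (tau n w) n0 p0 q0; rewrite -/(pt p K) -/(pt q K).
move=> h2; rewrite distrC; move: h2; move: (fine _) => a h2.
have := ler_distD (hits_at (tau n w) (pt p K) (pt q K)) a (F (pt p K) (pt q K)).
by move: (le_trans h1 le) (le_trans h2 n2); lra.
Unshelve. all: by end_near. Qed.

End almost_sure.

Theorem theorem7 (R : realType) (d : measure_display)
    (Omega : measurableType d) (P : probability Omega R) (beta : R)
    (tau : forall n : nat, Omega -> 'S_n)
    (htau : forall n : nat, (0 < n)%N -> is_mallows321 P beta (tau n)) :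
  (0 < beta ->
     is_permuton (mu321 beta) /\
     {ae P, forall w, permuton_cvg (fun n => tau n w) (mu321 beta)}) /\
  (beta <= 0 ->
     is_permuton (diagonal_permuton R) /\
     {ae P, forall w, permuton_cvg (fun n => tau n w) (diagonal_permuton R)}).
Proof.
split=> beta0.
  have perm := mu321_is_permuton beta0; split => //.
  apply: (ae_permuton_cvg htau _ (mu321_null beta0) (mu321_cdf beta0)).
    by case: perm => -> _ _ _; exact: ltry.
  exact: hits_concentration.
have perm := diagonal_is_permuton R; split => //.
apply: (ae_permuton_cvg htau _ (diagonal_null R) (@diagonal_cdf R)).
  by case: perm => -> _ _ _; exact: ltry.
exact: hits_concentration_diag.
Qed.
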